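(* Let $F$ be a field. (1) If $\mathrm{char}(F)=0$, then $F$ is hereditarily atomic if and only if $F$ is an algebraic extension of $\mathbb{Q}$ such that $\overline{\mathbb{Z}}_F$ is a Dedekind domain. (2) If $\mathrm{char}(F)=p$ for a prime $p$, then $F$ is hereditarily atomic if and only if the transcendence degree of $F$ over $\mathbb{F}_p$ is at most $1$ and $\overline{\mathbb{F}_p[x]}_F$ is a Dedekind domain for every $x\in F$.
   Context: An integral domain is atomic if every nonzero nonunit element factors into (finitely many) irreducible elements. An integral domain $R$ is hereditarily atomic if every subring of $R$ (with the same identity) is atomic. For an extension $R\subseteq S$ of integral domains, $\overline{R}_S$ denotes the integral closure of $R$ in $S$. In (2), $\mathbb{F}_p[x]$ denotes the subring of $F$ generated by $\mathbb{F}_p$ and the element $x\in F$. Fields are counted as Dedekind domains. *)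

(* Defs.v *)
From HB Require Import structures.
From mathcomp Require Import all_boot all_order all_algebra.
From mathcomp Require Import boolp classical_sets functions cardinality.
From mathcomp Require Import mpoly.

Set Implicit Arguments.
Unset Strict Implicit.
Unset Printing Implicit Defensive.

Import GRing.Theory.

Local Open Scope classical_set_scope.
Local Open Scope ring_scope.

(* Every integral domain considered here is a subring of a fixed field F.     *)
(* Such subrings are arbitrary subsets of F, hence are given as [set F]; the  *)
(* closure predicates of the algebraic hierarchy apply to them through [mem]. *)

Definition is_subring (F : fieldType) (R : set F) : Prop :=
  GRing.subring_closed (mem R).

Definition is_subfield (F : fieldType) (K : set F) : Prop :=
  GRing.divring_closed (mem K).

Definition generated_subring (F : fieldType) (A : set F) : set F :=
  smallest (@is_subring F) A.

Definition generated_subfield (F : fieldType) (A : set F) : set F :=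
  smallest (@is_subfield F) A.

(* The image of the canonical map from the integers: a copy of Z when F has   *)
(* characteristic 0, and the prime field F_p when F has characteristic p.     *)
Definition prime_subring (F : fieldType) : set F :=
  range (fun n : int => n%:~R : F).
Arguments prime_subring : clear implicits.

Definition unit_in (F : fieldType) (R : set F) (x : F) : Prop :=
  R x /\ exists2 y, R y & x * y = 1.

Definition irreducible_in (F : fieldType) (R : set F) (x : F) : Prop :=
  [/\ R x, x <> 0, ~ unit_in R x &
      forall a b, R a -> R b -> x = a * b -> unit_in R a \/ unit_in R b].

Definition atomic (F : fieldType) (R : set F) : Prop :=
  forall x, R x -> x <> 0 -> ~ unit_in R x ->
    exists2 s : seq F, [set` s] `<=` irreducible_in R & x = \prod_(a <- s) a.

Definition hereditarily_atomic (F : fieldType) (R : set F) : Prop :=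
  forall S : set F, is_subring S -> S `<=` R -> atomic S.

Definition integral_over (F : fieldType) (R : set F) (x : F) : Prop :=
  exists p : {poly F}, [/\ p \is monic, p \is a polyOver (mem R) & root p x].

Definition integral_closure (F : fieldType) (R S : set F) : set F :=
  [set x | S x /\ integral_over R x].

Definition fraction_field (F : fieldType) (R : set F) : set F :=
  [set x | exists a b, [/\ R a, R b, b <> 0 & x = a / b]].

Definition integrally_closed (F : fieldType) (R : set F) : Prop :=
  integral_closure R (fraction_field R) = R.

Definition is_ideal (F : fieldType) (R I : set F) : Prop :=
  [/\ I `<=` R, I 0, forall x y, I x -> I y -> I (x + y)
    & forall a x, R a -> I x -> I (a * x)].

Definition generated_ideal (F : fieldType) (R A : set F) : set F :=
  smallest (is_ideal R) A.

Definition noetherian (F : fieldType) (R : set F) : Prop :=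
  forall I, is_ideal R I ->
    exists2 s : seq F, [set` s] `<=` I & I = generated_ideal R [set` s].

Definition prime_ideal (F : fieldType) (R I : set F) : Prop :=
  [/\ is_ideal R I, I <> R
    & forall a b, R a -> R b -> I (a * b) -> I a \/ I b].

Definition maximal_ideal (F : fieldType) (R I : set F) : Prop :=
  [/\ is_ideal R I, I <> R
    & forall J, is_ideal R J -> I `<=` J -> J = I \/ J = R].

(* The zero ideal is not required to be non-maximal: fields qualify. *)
Definition dedekind (F : fieldType) (R : set F) : Prop :=
  [/\ is_subring R, noetherian R, integrally_closed R
    & forall P, prime_ideal R P -> P <> [set 0] -> maximal_ideal R P].

Definition algebraic_over (F : fieldType) (K : set F) (x : F) : Prop :=
  exists p : {poly F}, [/\ p != 0, p \is a polyOver (mem K) & root p x].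

Definition algebraically_independent (F : fieldType) (K B : set F) : Prop :=
  forall (n : nat) (t : n.-tuple F), uniq t -> [set` t] `<=` B ->
  forall q : {mpoly F[n]}, q \is a mpolyOver n (mem K) ->
    q.@[tnth t] = 0 -> q = 0.

Definition transcendence_basis (F : fieldType) (K B : set F) : Prop :=
  algebraically_independent K B /\
  forall x, algebraic_over (generated_subfield (K `|` B)) x.

(* The transcendence degree of F over its subfield K is the cardinality of    *)
(* any transcendence basis; this says that it is at most n.                   *)
Definition trdeg_le (F : fieldType) (K : set F) (n : nat) : Prop :=
  exists2 B : set F, transcendence_basis K B & (B #<= `I_n)%card.

(* Main.v *)
From HB Require Import structures.
Require Import Defs.
From mathcomp Require Import all_boot all_order all_algebra.
From mathcomp Require Import boolp classical_sets functions cardinality.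
From mathcomp Require Import mpoly ring.

Set Implicit Arguments.
Unset Strict Implicit.
Unset Printing Implicit Defensive.

Import Order.TTheory GRing.Theory Num.Theory.

Local Open Scope classical_set_scope.
Local Open Scope ring_scope.

(** Let [A] be the ring of integers, in characteristic 0, or [K[x]] with [K] the
    prime field and [x] transcendental, in characteristic p.  It is a principal
    ideal domain with finite proper quotients, and [F] turns out to be algebraic
    over it.  Let [O] be the integral closure of [A] in [F].  Two elementary
    properties of [O] carry the proof.  First, [O] is a Pruefer domain: a
    relation of [y] over [A] with coefficients generating the unit ideal yields
    an inverse of the fractional ideal generated by [1] and [y]
    ([closure_pid_prufer]).  Second, modulo a nonzero element every element of
    [O] has an idempotent power, because [A] has finite quotients
    ([closure_pid_idempotent_powers]).

    If [F] is hereditarily atomic, it is algebraic over [A]: for [c] a nonzero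
    nonunit of a subring [A] and [y] transcendental over [A], the ring
    [A + y A[1/c][y]] is not atomic, since every element without constant term
    is divisible by [c] ([constant_term_ring_not_atomic]).  It remains to see
    that [O] is Noetherian.  Given an ideal containing a nonzero nonunit [m],
    localize [O] at the elements prime to [m].  Idempotent powers modulo [m]
    allow one to glue local generators, so the localization is a Bezout domain
    ([localized_bezout]); it is atomic by hypothesis, so the extension of the
    ideal is principal, and the ideal itself is generated by two elements.
    Nonzero primes are maximal, again by idempotent powers.  For algebraic [x]
    the integral closure of [K[x]] is a field.

    Conversely, let [O] be Noetherian and let [R] be a subring containing [A],
    with integral closure [T] in [F].  As [O] is Pruefer, every ideal of [T] is
    generated by its elements in [O], so [T] satisfies the ascending chain
    condition.  Units of [T] in [R] are units of [R], so [R] satisfies it for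
    principal ideals and is atomic ([noetherian_prufer_atomic]).  In
    characteristic p, a subring containing no transcendental element is a field,
    and otherwise the exchange property makes [F] algebraic over [K[x]] for any
    transcendental [x] in [R] ([trdeg_le1_algebraic]). *)

(** * Subrings given as sets, and polynomials over them *)

Section Subring.
Variables (F : fieldType) (R : set F).
Hypothesis hR : is_subring R.

Lemma subring1 : R 1.
Proof. by case: hR => /set_mem. Qed.

Lemma subringB x y : R x -> R y -> R (x - y).
Proof.
by case: hR => _ hB _ Rx Ry; apply: set_mem; apply: hB; apply: mem_set.
Qed.

Lemma subringM x y : R x -> R y -> R (x * y).
Proof.
by case: hR => _ _ hM Rx Ry; apply: set_mem; apply: hM; apply: mem_set.
Qed.

Lemma subring0 : R 0.
Proof. by rewrite -(subrr 1); apply: subringB; apply: subring1. Qed.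

Lemma subringN x : R x -> R (- x).
Proof. by move=> Rx; rewrite -sub0r; apply: subringB => //; apply: subring0. Qed.

Lemma subringD x y : R x -> R y -> R (x + y).
Proof. by move=> Rx Ry; rewrite -[y]opprK; apply: subringB => //; apply: subringN. Qed.

Lemma subringX x n : R x -> R (x ^+ n).
Proof.
move=> Rx; elim: n => [|n IHn]; first exact: subring1.
by rewrite exprS; apply: subringM.
Qed.

Lemma subring_nat n : R n%:R.
Proof.
by elim: n => [|n IHn]; [exact: subring0|rewrite mulrSr; apply: subringD => //; exact: subring1].
Qed.

Lemma subring_sum (I : Type) (r : seq I) (P : pred I) (f : I -> F) :
  (forall i, P i -> R (f i)) -> R (\sum_(i <- r | P i) f i).
Proof. by move=> Rf; apply: big_ind => //; [exact: subring0|exact: subringD]. Qed.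

Lemma subring_prod (s : seq F) : [set` s] `<=` R -> R (\prod_(a <- s) a).
Proof.
move=> sR; rewrite big_seq; apply: big_ind => [||a /= sa]; last exact: sR.
  exact: subring1.
exact: subringM.
Qed.

Lemma subring_horner (p : {poly F}) x :
  (forall i, R p`_i) -> R x -> R p.[x].
Proof.
move=> Rp Rx; rewrite horner_coef; apply: subring_sum => i _.
by apply: subringM; [exact: Rp|exact: subringX].
Qed.

Lemma subring_coefM (p q : {poly F}) :
  (forall i, R p`_i) -> (forall i, R q`_i) -> forall i, R (p * q)`_i.
Proof.
by move=> Rp Rq i; rewrite coefM; apply: subring_sum => j _; apply: subringM.
Qed.

Lemma polyOver_subring (p : {poly F}) :
  p \is a polyOver (mem R) <-> forall i, R p`_i.
Proof.
split=> [/allP Rp i|Rp].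
  case: (ltnP i (size p)) => hi; first exact: set_mem (Rp _ (mem_nth 0 hi)).
  by rewrite nth_default //; apply: subring0.
by apply/(all_nthP 0) => i _; apply/mem_set/Rp.
Qed.

End Subring.

Ltac subring h :=
  repeat first [ assumption | solve [auto 1 with nocore]
    | exact: (subring0 h) | exact: (subring1 h) | exact: (subring_nat h)
    | apply: (subringB h) | apply: (subringN h) | apply: (subringD h) | apply: (subringM h)
    | apply: (subringX h) ].

Lemma prime_subringP (F : fieldType) : is_subring (prime_subring F).
Proof.
split=> [|x y|x y].
- by apply: mem_set; exists 1.
- by move=> /set_mem [m _ <-] /set_mem [n _ <-];
  apply: mem_set; exists (m - n) => //; rewrite rmorphB.
- by move=> /set_mem [m _ <-] /set_mem [n _ <-];
  apply: mem_set; exists (m * n) => //; rewrite rmorphM.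
Qed.

Lemma prime_subring_sub (F : fieldType) (R : set F) :
  is_subring R -> prime_subring F `<=` R.
Proof.
move=> hR _ [n _ <-]; case: n => n; first exact: (subring_nat hR).
by rewrite NegzE rmorphN; apply: (subringN hR); apply: (subring_nat hR).
Qed.

(** * Integral closure *)

Section SubringType.
Variables (F : fieldType) (R : set F) (hR : is_subring R).

(** The subring as a type of its own, so that the theory of integral elements
    over a ring morphism applies to its inclusion in the field. *)
Definition subring_type of is_subring R := {x : F | x \in R}.
HB.instance Definition _ := SubChoice.on (subring_type hR).
HB.instance Definition _ :=
  GRing.SubChoice_isSubComNzRing.Build F (mem R) (subring_type hR) hR.

Lemma integral_overP x :
  integral_over R x <-> integralOver (val : subring_type hR -> F) x.
Proof.
split=> [[p [pm /(polyOver_subring hR) pR px]]|[p pm px]].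
  pose c i : subring_type hR := exist (fun y => y \in R) p`_i (mem_set (pR i)).
  have pE : map_poly (val : subring_type hR -> F) (\poly_(i < size p) c i) = p.
    apply/polyP => i; rewrite coef_map coef_poly.
    by case: ltnP => // hi; rewrite nth_default.
  exists (\poly_(i < size p) c i); last by rewrite pE.
  move: pm; rewrite -{1}pE !monicE lead_coef_map_inj ?rmorph0 //.
exists (map_poly val p); split=> //; first exact: monic_map.
by apply/(polyOver_subring hR) => i; rewrite coef_map; apply/set_mem/valP.
Qed.

End SubringType.

Section IntegralClosure.
Variables (F : fieldType) (R : set F).
Hypothesis hR : is_subring R.
Local Notation cl := (integral_closure R [set: F]).

Lemma integral_over_coef x :
  integral_over R x <->
  exists p : {poly F}, [/\ p \is monic, forall i, R p`_i & p.[x] = 0].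
Proof.
by split=> [] [p [pm pR px]]; exists p; split=> //; by [apply/polyOver_subring | apply/rootP].
Qed.

Lemma algebraic_over_coef x :
  algebraic_over R x <->
  exists p : {poly F}, [/\ p != 0, forall i, R p`_i & p.[x] = 0].
Proof.
by split=> [] [p [pm pR px]]; exists p; split=> //; by [apply/polyOver_subring | apply/rootP].
Qed.

Lemma sub_integral_closure : R `<=` cl.
Proof.
move=> x Rx; split=> //; apply/(integral_overP hR).
have -> : x = val (exist (fun y => y \in R) x (mem_set Rx) : subring_type hR) by [].
exact: integral_id.
Qed.

Lemma integral_closure_subring : is_subring cl.
Proof.
split=> [|x y|x y].
- by apply: mem_set; apply: sub_integral_closure; exact: (subring1 hR).
- move=> /set_mem [_ /(integral_overP hR) hx] /set_mem [_ /(integral_overP hR) hy].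
  by apply: mem_set; split=> //; apply/(integral_overP hR)/integral_sub.
- move=> /set_mem [_ /(integral_overP hR) hx] /set_mem [_ /(integral_overP hR) hy].
  by apply: mem_set; split=> //; apply/(integral_overP hR)/integral_mul.
Qed.

Lemma integral_closure_root x (p : {poly F}) :
  p \is monic -> (forall i, cl p`_i) -> p.[x] = 0 -> cl x.
Proof.
move=> pm pcl px; split=> //; apply/(integral_overP hR).
apply: (integral_root_monic pm); first exact/rootP.
by apply/integral_poly => i; apply/(integral_overP hR); case: (pcl i).
Qed.

End IntegralClosure.

Lemma integral_over_sub (F : fieldType) (R S : set F) x :
  is_subring R -> is_subring S -> R `<=` S -> integral_over R x -> integral_over S x.
Proof.
move=> hR hS RS /(integral_over_coef hR) [p [pm pR px]].
by apply/(integral_over_coef hS); exists p; split=> // i; apply: RS.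
Qed.

Lemma integral_closure_closed (F : fieldType) (R : set F) :
  is_subring R -> integrally_closed (integral_closure R [set: F]).
Proof.
move=> hR; have hO := integral_closure_subring hR; apply/seteqP; split=> x.
  case=> _ /(integral_over_coef hO) [p [pm pO px]].
  exact: (integral_closure_root hR pm).
move=> Ox; split; last by have [] := sub_integral_closure hO Ox.
by exists x, 1; rewrite divr1; split=> //; [exact: subring1|exact/eqP/oner_neq0].
Qed.

(** Dividing a polynomial relation of [y] by a power of the variable makes its
    constant term nonzero; that term is then a multiple of [y]. *)
Lemma algebraic_dvd_base (F : fieldType) (R T : set F) (y : F) (p : {poly F}) :
  is_subring T -> R `<=` T -> T y -> y != 0 ->
  p != 0 -> (forall i, R p`_i) -> p.[y] = 0 ->
  exists n w, [/\ R n, n != 0, T w & - n = y * w].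
Proof.
move=> hT RT Ty y0; elim/poly_ind: p => [|p c IHp]; first by rewrite eqxx.
move=> pc0 pcR; rewrite hornerMXaddC.
have Rc : R c by have := pcR 0; rewrite coefD coefMX coefC eqxx add0r.
have Rp i : R p`_i by have := pcR i.+1; rewrite coefD coefMX coefC addr0.
have [c0|c0] := eqVneq c 0.
  move: pc0; rewrite c0 !addr0 mulf_eq0 polyX_eq0 orbF => p0 /eqP.
  by rewrite mulf_eq0 (negPf y0) orbF => /eqP py; apply: IHp.
move=> /eqP; rewrite addr_eq0 => /eqP h; exists c, p.[y]; split=> //.
  by apply: (subring_horner hT) => // i; apply: RT.
by rewrite -h mulrC.
Qed.

(** Multiplied by a power of [b], the equation of [b^-1] expresses [b^-1] as a
    polynomial in [b]; hence a nonunit of [R] stays a nonunit in an integral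
    extension. *)
Lemma integral_inv_mem (F : fieldType) (R : set F) (b : F) :
  is_subring R -> R b -> b != 0 -> integral_over R b^-1 -> R b^-1.
Proof.
move=> hR Rb b0 /(integral_over_coef hR) [p [pm pR]].
have : (0 < size p)%N by rewrite size_poly_gt0 monic_neq0.
case E: (size p) => [//|[|d]] _.
  have /size_poly1P [c c0 pE] : size p == 1%N by rewrite E.
  by move=> /eqP; rewrite pE hornerC (negPf c0).
rewrite horner_coef E big_ord_recr /=.
have -> : p`_d.+1 = 1 by rewrite -(monicP pm) lead_coefE E.
rewrite mul1r => /eqP; rewrite addr_eq0 => /eqP h.
have -> : b^-1 = - (b ^+ d * \sum_(i < d.+1) p`_i * b^-1 ^+ i).
  by rewrite h mulrN opprK exprS mulrCA -exprMn mulfV // expr1n mulr1.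
apply: (subringN hR); rewrite mulr_sumr; apply: (subring_sum hR) => i _.
rewrite mulrCA; apply: (subringM hR) => //.
have -> : b ^+ d * b^-1 ^+ i = b ^+ (d - i).
  by rewrite -{1}(@subnK i d) -1?ltnS // exprD -mulrA -exprMn mulfV // expr1n mulr1.
exact: (subringX hR).
Qed.

Lemma clear_denominators (F : fieldType) (R : set F) (p : {poly F}) :
  is_subring R -> (forall i, fraction_field R p`_i) ->
  exists d, [/\ R d, d != 0 & forall i, R (d * p`_i)].
Proof.
move=> hR; elim/poly_ind: p => [|p c IHp] pcR.
  exists 1; rewrite oner_neq0; split=> // [|i]; first exact: subring1.
  by rewrite coef0 mulr0; apply: subring0.
have [i|d [Rd d0 dR]] := IHp.
  by have := pcR i.+1; rewrite coefD coefMX coefC addr0.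
have := pcR 0; rewrite coefD coefMX coefC eqxx add0r => -[a [b [Ra Rb /eqP b0 cE]]].
exists (d * b); rewrite mulf_neq0 //; split=> // [|i]; first exact: subringM.
rewrite coefD coefMX coefC; case: i => [|i] /=.
  by rewrite add0r cE -mulrA [b * _]mulrC divfK //; apply: subringM.
by rewrite addr0 mulrAC; apply: subringM.
Qed.

Lemma algebraic_over_fraction_field (F : fieldType) (R : set F) x :
  is_subring R -> is_subring (fraction_field R) ->
  algebraic_over (fraction_field R) x -> algebraic_over R x.
Proof.
move=> hR hK /(algebraic_over_coef hK) [p [p0 pK px]].
have [d [Rd d0 dR]] := clear_denominators hR pK.
apply/(algebraic_over_coef hR); exists (d *: p).
by rewrite scaler_eq0 negb_or d0 p0 hornerZ px mulr0; split=> // i; rewrite coefZ.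
Qed.

Section Subfield.
Variables (F : fieldType) (K : set F).
Hypothesis hK : is_subfield K.

Lemma subfield_inv x : K x -> K x^-1.
Proof.
move=> Kx; case: hK => K1 _ KV; rewrite -[x^-1]mul1r.
by apply: set_mem; apply: KV => //; apply: mem_set.
Qed.

Lemma subfield_subring : is_subring K.
Proof.
have [K1 KB KV] := hK; split=> // x y Kx Ky; rewrite -[y]invrK; apply: KV => //.
by apply: mem_set; apply: subfield_inv; apply: set_mem.
Qed.

Lemma algebraic_integral_over x : algebraic_over K x -> integral_over K x.
Proof.
have hR := subfield_subring; move=> /(algebraic_over_coef hR) [p [p0 pK px]].
apply/(integral_over_coef hR); exists ((lead_coef p)^-1 *: p); split.
- by rewrite monicE lead_coefZ mulVf // lead_coef_eq0.
- by move=> i; rewrite coefZ; apply: (subringM hR) => //; apply: subfield_inv; apply: pK.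
- by rewrite hornerZ px mulr0.
Qed.

(** The inverse of an algebraic element is a polynomial expression in it. *)
Lemma algebraic_inv_mem (T : set F) y :
  is_subring T -> K `<=` T -> T y -> y != 0 -> algebraic_over K y -> T y^-1.
Proof.
move=> hT KT Ty y0 /(algebraic_over_coef subfield_subring) [p [p0 pK py]].
have [n [w [Kn n0 Tw nE]]] := algebraic_dvd_base hT KT Ty y0 p0 pK py.
have w0 : w != 0 by move: n0; rewrite -oppr_eq0 nE mulf_eq0 negb_or => /andP[].
have -> : y^-1 = (- n)^-1 * w by rewrite nE invfM -mulrA mulVf // mulr1.
by apply: (subringM hT) => //; apply: KT; apply: subfield_inv; apply: (subringN subfield_subring).
Qed.

End Subfield.

Lemma subring_subfield (F : fieldType) (K : set F) :
  is_subring K -> (forall x, K x -> x != 0 -> K x^-1) -> is_subfield K.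
Proof.
move=> [K1 KB KM] KV; split=> // x y Kx Ky; apply: KM => //.
have [->|y0] := eqVneq y 0; last by apply: mem_set; apply: KV => //; apply: set_mem.
by rewrite invr0 -(subrr 1); apply: KB.
Qed.

Lemma integral_closure_subfield (F : fieldType) (K : set F) :
  is_subfield K -> is_subfield (integral_closure K [set: F]).
Proof.
move=> hK; have hR := subfield_subring hK; have hO := integral_closure_subring hR.
apply: subring_subfield => // y [_ /(integral_over_coef hR) [p [pm pK py]]] y0.
apply: (algebraic_inv_mem hK) => //; first exact: sub_integral_closure.
  by split=> //; apply/(integral_over_coef hR); exists p.
by apply/(algebraic_over_coef hR); exists p; split=> //; apply: monic_neq0.
Qed.

Lemma fraction_field_subfield (F : fieldType) (R : set F) :
  is_subring R -> is_subfield (fraction_field R).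
Proof.
move=> hR; split=> [|x y|x y].
- apply: mem_set; exists 1, 1; rewrite divr1; split=> //; try exact: subring1.
  exact/eqP/oner_neq0.
- move=> /set_mem [a [b [Ra Rb /eqP b0 ->]]] /set_mem [c [d [Rc Rd /eqP d0 ->]]].
  apply: mem_set; exists (a * d - c * b), (b * d).
  split; [subring hR|subring hR|by apply/eqP; rewrite mulf_neq0|by field; rewrite b0 d0].
- move=> /set_mem [a [b [Ra Rb /eqP b0 ->]]] /set_mem [c [d [Rc Rd /eqP d0 ->]]].
  apply: mem_set; have [c0|c0] := eqVneq c 0.
    exists 0, 1; rewrite c0 mul0r invr0 mulr0 mul0r.
    by split=> //; [exact: subring0|exact: subring1|exact/eqP/oner_neq0].
  exists (a * d), (b * c).
  split; [subring hR|subring hR|by apply/eqP; rewrite mulf_neq0|by field; rewrite b0 c0 d0].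
Qed.

Lemma sub_fraction_field (F : fieldType) (R : set F) :
  is_subring R -> R `<=` fraction_field R.
Proof.
by move=> hR x Rx; exists x, 1; rewrite divr1; split=> //; [exact: subring1|exact/eqP/oner_neq0].
Qed.

(** * Integral closures of principal ideal domains with finite residue rings *)

(** Every fractional ideal generated by [1] and [y] is invertible: [l] and [l']
    lie in its inverse and witness that the product of the two is the unit
    ideal. *)
Definition prufer (F : fieldType) (O : set F) :=
  forall y, exists l l', [/\ O l, O l', O (l * y), O (l' * y) & l + l' * y = 1].

Definition idempotent_powers (F : fieldType) (O : set F) :=
  forall m a, O m -> m != 0 -> O a ->
  exists N z, [/\ (0 < N)%N, O z & a ^+ N - a ^+ N ^+ 2 = m * z].

Definition is_pid (F : fieldType) (A : set F) :=
  is_subring A /\ forall I, is_ideal A I ->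
  exists2 g, I g & forall x, I x -> exists2 a, A a & x = a * g.

(** The finiteness of all proper quotients of [A], as a colouring by finitely
    many colours that separates residue classes. *)
Definition finite_residues (F : fieldType) (A : set F) :=
  forall n, A n -> n != 0 ->
  exists (T : finType) (c : F -> T), forall a b, A a -> A b -> c a = c b ->
  exists2 z, A z & a - b = n * z.

Lemma pigeonhole_nat (T : finType) (f : nat -> T) :
  exists i j, (i < j)%N /\ f i = f j.
Proof.
pose g (i : 'I_#|T|.+1) := f i.
have : ~~ injectiveb g.
  by apply/negP => /injectiveP /leq_card; rewrite card_ord ltnn.
move=> /injectivePn [i [j ij gij]].
have [h|h|/val_inj h] := ltngtP i j.
- by exists i, j.
- by exists j, i.
- by rewrite h eqxx in ij.
Qed.

(** A Euclidean step by a polynomial whose leading coefficient is a unit of [R]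
    does not leave [R]. *)
Lemma subring_modp (F : fieldType) (R : set F) (f r : {poly F}) :
  is_subring R -> f != 0 -> (forall i, R f`_i) -> R (lead_coef f)^-1 ->
  (forall i, R r`_i) ->
  exists s t : {poly F}, [/\ forall i, R s`_i, forall i, R t`_i,
    (size t < size f)%N & r = s * f + t].
Proof.
move=> hR f0 fR RV; have [n] := ubnP (size r); elim: n r => // n IHn r rn rR.
case: (ltnP (size r) (size f)) => [rf|fr].
  exists 0, r; rewrite mul0r add0r; split=> // i.
  by rewrite coef0; apply: subring0.
pose u := lead_coef r / lead_coef f *: 'X^(size r - size f).
have uR i : R u`_i.
  rewrite coefZ coefXn; apply: (subringM hR); last exact: (subring_nat hR).
  by apply: (subringM hR) => //; apply: rR.
have ufR := subring_coefM hR uR fR.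
have r0 : (0 < size r)%N by apply: (leq_trans _ fr); rewrite size_poly_gt0.
have /IHn [i|s [t [sR tR tf rE]]] : (size (r - u * f)%R < n)%N.
- rewrite ltnS in rn; apply: (leq_trans _ rn).
  rewrite -[X in (_ < X)%N](prednK r0) ltnS; apply/leq_sizeP => j; rewrite leq_eqVlt => /orP[/eqP <-|jr].
    rewrite coefB -scalerAl coefZ coefXnM.
    have fs : (size f).-1 = ((size r).-1 - (size r - size f))%N.
      by rewrite -subn1 -(subn1 (size r)) subnAC subKn.
    rewrite ltnNge -subn1 leq_sub2l ?size_poly_gt0 //= subn1 -fs.
    by rewrite -!lead_coefE divfK ?subrr // lead_coef_eq0.
  rewrite nth_default // (leq_trans (size_polyD _ _)) // size_polyN geq_max.
  rewrite -(prednK r0) jr /= -scalerAl (leq_trans (size_scale_leq _ _)) //.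
  rewrite (leq_trans (size_polyMleq _ _)) // size_polyXn /= subnK // -(prednK r0) //.
- by rewrite coefB; apply: (subringB hR).
exists (u + s), t; split=> // [i|]; first by rewrite coefD; apply: (subringD hR).
by rewrite mulrDl -addrA -rE addrC subrK.
Qed.

(** The ideal of those combinations of [1] and [y] that have coefficients in
    the inverse of the fractional ideal they generate. *)
Definition inverse_pairing (F : fieldType) (O : set F) (y c : F) :=
  exists l l', [/\ O l, O l', O (l * y), O (l' * y) & c = l + l' * y].

Section InversePairing.
Variables (F : fieldType) (O : set F) (y : F).
Hypothesis hO : is_subring O.
Hypothesis clO : forall x, integral_over O x -> O x.
Local Notation M := (inverse_pairing O y).

Lemma inverse_pairingD c d : M c -> M d -> M (c + d).
Proof.
move=> [a [a' [Oa Oa' Oay Oa'y ->]]] [b [b' [Ob Ob' Oby Ob'y ->]]].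
by exists (a + b), (a' + b'); split; rewrite ?mulrDl; subring hO; rewrite addrACA.
Qed.

Lemma inverse_pairingM a c : O a -> M c -> M (a * c).
Proof.
move=> Oa [b [b' [Ob Ob' Oby Ob'y ->]]].
exists (a * b), (a * b'); rewrite mulrDr -!mulrA; split=> //; subring hO.
Qed.

(** The leading coefficient [c] of a relation [q] of [y] makes [c * y] integral;
    replacing the leading term of [q] by [c * y] times the previous power of the
    variable gives a shorter relation whose coefficients differ from those of
    [q] by elements of the ideal. *)
Lemma coef_inverse_pairing (q : {poly F}) i :
  (forall i, O q`_i) -> q.[y] = 0 -> M q`_i.
Proof.
have M0 : M 0.
  by exists 0, 0; rewrite !mul0r addr0; split=> //; apply: subring0.
have [n] := ubnP (size q); elim: n q i => // n IHn q i qn qO qy.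
case E: (size q) => [|[|d]].
- by rewrite nth_default ?E.
- have /size_poly1P [c c0 qE] : size q == 1%N by rewrite E.
  by move: qy; rewrite qE hornerC => /eqP; rewrite (negPf c0).
pose c := q`_d.+1.
have Oc : O c by apply: qO.
have c0 : c != 0 by rewrite /c -[d.+1]/(d.+2.-1) -E -lead_coefE lead_coef_eq0 -size_poly_eq0 E.
have qyE : \sum_(i < d.+1) q`_i * y ^+ i + c * y ^+ d.+1 = 0.
  by rewrite -[RHS]qy horner_coef E [RHS]big_ord_recr.
have Ocy : O (c * y).
  apply: clO; apply/(integral_over_coef hO).
  pose r := \poly_(i < d.+1) (q`_i * c ^+ (d - i)).
  have sr : (size r < size ('X^(d.+1) : {poly F})%R)%N by rewrite size_polyXn ltnS size_poly.
  exists ('X^(d.+1) + r); split.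
  - by rewrite monicE lead_coefDl // lead_coefXn.
  - move=> j; rewrite coefD coefXn; apply: (subringD hO); first exact: (subring_nat hO).
    rewrite coef_poly; case: ifP => _; last exact: (subring0 hO).
    by subring hO.
  - rewrite hornerD hornerXn horner_poly -[RHS](mulr0 (c ^+ d)) -[X in _ = _ * X]qyE mulrDr addrC.
    congr (_ + _); last by rewrite exprMn exprS; ring.
    rewrite mulr_sumr; apply: eq_bigr => j _.
    have -> : c ^+ d = c ^+ (d - j) * c ^+ j by rewrite -exprD subnK // -ltnS.
    by rewrite exprMn; ring.
pose q' := q - c *: 'X^(d.+1) + (c * y) *: 'X^d.
have q'E j : q'`_j = q`_j - c * (j == d.+1)%:R + c * y * (j == d)%:R.
  by rewrite coefD coefB !coefZ !coefXn.
have q'M j : M q'`_j.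
  apply: IHn.
  - rewrite E !ltnS in qn; apply: (leq_trans _ qn); rewrite ltnS; apply/leq_sizeP => k.
    rewrite leq_eqVlt => /orP[/eqP <-|dk]; rewrite q'E.
      by rewrite eqxx mulr1 subrr add0r gtn_eqF // mulr0.
    by rewrite nth_default ?E // gtn_eqF // mulr0 subr0 add0r gtn_eqF ?mulr0 // ltnW.
  - by move=> k; rewrite q'E; subring hO.
  - by rewrite !(hornerD, hornerN, hornerZ, hornerXn) qy exprS; ring.
have Mc : M c by exists c, 0; rewrite !mul0r addr0; split=> //; apply: (subring0 hO).
have Mcy : M (- (c * y)).
  exists 0, (- c); rewrite mul0r add0r mulNr; split=> //; subring hO.
have -> : q`_i = q'`_i + (i == d.+1)%:R * c + (i == d)%:R * - (c * y).
  by rewrite q'E; ring.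
by do !apply: inverse_pairingD => //; apply: inverse_pairingM => //; apply: (subring_nat hO).
Qed.

End InversePairing.

Lemma generated_idealP (F : fieldType) (O C : set F) :
  is_subring O -> C `<=` O -> is_ideal O (generated_ideal O C).
Proof.
move=> hO CO; split.
- by apply: smallest_sub => //; split=> //; [exact: subring0|exact: subringD|exact: subringM].
- by move=> I [[]].
- by move=> a b Ca Cb I hI; case: (hI) => -[_ _ ID _] _; apply: ID; [apply: Ca|apply: Cb].
- by move=> a b Aa Cb I hI; case: (hI) => -[_ _ _ IM] _; apply: IM => //; apply: Cb.
Qed.

Section ClosureOfPID.
Variables (F : fieldType) (A : set F).
Hypothesis pidA : is_pid A.
Hypothesis algA : forall x, algebraic_over A x.
Local Notation O := (integral_closure A [set: F]).
Let hA : is_subring A := proj1 pidA.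
Let hO : is_subring O := integral_closure_subring hA.
Let AO : A `<=` O := sub_integral_closure hA.

(** Divided by a generator of the ideal of its coefficients, a relation of [y]
    over [A] has coefficients generating the unit ideal; all of them lie in the
    inverse pairing of [y], which therefore contains [1]. *)
Lemma closure_pid_prufer : prufer O.
Proof.
move=> y; suff [l [l' [? ? ? ? h]]] : inverse_pairing O y 1 by exists l, l'.
have clO x : integral_over O x -> O x.
  by move=> /(integral_over_coef hO) [p [pm pO px]]; apply: (integral_closure_root hA pm).
have /(algebraic_over_coef hA) [p [p0 pA py]] := algA y.
pose C : set F := [set p`_i | i in [set: nat]].
have idC : is_ideal A (generated_ideal A C).
  by apply: generated_idealP => // _ [i _ <-].
have [g Cg gP] := (proj2 pidA) _ idC.
have pg i : exists2 a, A a & p`_i = a * g.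
  by apply: gP; apply: sub_gen_smallest; exists i.
have g0 : g != 0.
  apply: contra_neq p0 => g0; apply/polyP => i.
  by have [a _ ->] := pg i; rewrite g0 mulr0 coef0.
rewrite -(mulfV g0).
suff : [set w | A w /\ inverse_pairing O y (w / g)] g by case.
apply: Cg; split; first split.
- by move=> w [].
- split; first exact: subring0.
  by exists 0, 0; rewrite !mul0r addr0; split=> //; apply: (subring0 hO).
- move=> u v [Au Mu] [Av Mv]; split; first exact: subringD.
  by rewrite mulrDl; apply: inverse_pairingD.
- move=> a u Aa [Au Mu]; split; first exact: subringM.
  by rewrite -mulrA; apply: inverse_pairingM => //; apply: AO.
- move=> _ [i _ <-]; split=> //.
  rewrite mulrC -coefZ; apply: coef_inverse_pairing => //.
    by move=> j; have [a Aa] := pg j; rewrite coefZ => ->; apply: AO; rewrite mulrC mulfK.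
  by rewrite hornerZ py mulr0.
Qed.

Hypothesis finA : finite_residues A.

(** Modulo a nonzero [n] of [A] there are finitely many [A]-combinations of
    the powers [a ^+ j] below the degree of [a], so two powers of [a] agree and
    a suitable power is idempotent; a general modulus divides such an [n]. *)
Lemma closure_pid_idempotent_powers : idempotent_powers O.
Proof.
move=> m a Om m0 Oa.
have [_ /(integral_over_coef hA) [p [pm pA pm0]]] := Om.
have [n [w [An n0 Ow nE]]] := algebraic_dvd_base hO AO Om m0 (monic_neq0 pm) pA pm0.
have [_ /(integral_over_coef hA) [f [fm fA fa]]] := Oa.
have [T [c cP]] := finA An n0.
have /choice [r rP] i : exists t : {poly F},
    [/\ forall j, A t`_j, (size t < size f)%N & a ^+ i = t.[a]].
  have lA : A (lead_coef f)^-1 by rewrite (monicP fm) invr1; apply: (subring1 hA).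
  have [j|s [t [sA tA tf iE]]] := @subring_modp _ _ f 'X^i hA (monic_neq0 fm) fA lA.
    by rewrite coefXn; apply: (subring_nat hA).
  by exists t; split=> //; rewrite -hornerXn iE hornerD hornerM fa mulr0 add0r.
have [i [j [ij]]] := pigeonhole_nat (fun i => [ffun k : 'I_(size f) => c (r i)`_k]).
move=> /ffunP rE.
have [z Oz zE] : exists2 z, O z & a ^+ i - a ^+ j = n * z.
  have [riA ri ->] := rP i; have [rjA rj ->] := rP j.
  have /choice [v vP] (k : 'I_(size f)) : exists z, A z /\ (r i)`_k - (r j)`_k = n * z.
    by have := rE k; rewrite !ffunE => /cP [] // z Az zE; exists z.
  exists (\sum_(k < size f) v k * a ^+ k).
    apply: (subring_sum hO) => k _; apply: (subringM hO); last exact: (subringX hO).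
    by apply: AO; have [] := vP k.
  rewrite (horner_coef_wide _ (ltnW ri)) (horner_coef_wide _ (ltnW rj)) -sumrB mulr_sumr.
  by apply: eq_bigr => k _; have [_] := vP k; rewrite mulrA => <-; rewrite mulrBl.
(* [N] is a multiple of the period [k] that lies beyond the preperiod [i]. *)
pose k := (j - i)%N; pose N := (k * i.+1)%N.
have k0 : (0 < k)%N by rewrite subn_gt0.
have iN : (i <= N)%N by rewrite (leq_trans (leqnSn i)) // leq_pmull.
pose G := \sum_(t < i.+1) (a ^+ k) ^+ t.
exists N, (- (a ^+ (N - i) * G * w * z)); split.
- by rewrite muln_gt0 k0.
- apply: (subringN hO); do !apply: (subringM hO) => //; first exact: (subringX hO).
  by apply: (subring_sum hO) => t _; do !apply: (subringX hO).
have -> : a ^+ N - a ^+ N ^+ 2 = a ^+ (N - i) * G * (a ^+ i - a ^+ j).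
  have <- : (i + k = j)%N by rewrite subnKC // ltnW.
  have GE : (a ^+ k - 1) * G = a ^+ N - 1 by rewrite -subrX1 -exprM.
  have NE : a ^+ N = a ^+ (N - i) * a ^+ i by rewrite -exprD subnK.
  rewrite exprD; transitivity (- (a ^+ N) * (a ^+ N - 1)); first by ring.
  by rewrite -GE {1}NE; ring.
by rewrite zE -[n]opprK nE; ring.
Qed.

End ClosureOfPID.

(** * Atomic Bezout domains *)

(** The element [v] generates the inverse of the fractional ideal generated by
    [1] and [t], so that this ideal is principal. *)
Definition bezout (F : fieldType) (D : set F) :=
  forall t, exists v a b, [/\ D v, D (v * t), D a, D b & a * v + b * (v * t) = 1].

Section BezoutAtomic.
Variables (F : fieldType) (D : set F).
Hypothesis hD : is_subring D.
Hypothesis bezD : bezout D.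

Lemma bezout_gcd x y : x != 0 -> D x -> D y ->
  exists g c d a b, [/\ D c, D d, D a & D b] /\ [/\ D g, x = c * g, y = d * g & g = a * x + b * y].
Proof.
move=> x0 Dx Dy; have [v [a [b [Dv Dvt Da Db h]]]] := bezD (y / x).
have v0 : v != 0.
  by apply/eqP => v0; move/eqP: h; rewrite v0 !mul0r !mulr0 addr0 eq_sym oner_eq0.
have gE : x / v = a * x + b * y.
  by rewrite -[LHS]mulr1 -h; field; rewrite v0 x0.
exists (x / v), v, (v * (y / x)), a, b; split=> //; split.
- by rewrite gE; subring hD.
- by field.
- by field; rewrite v0 x0.
- by [].
Qed.

(** The gcd of [p] and [x] is associated to [p] or a unit; in the second case
    a Bezout relation, multiplied by [y], shows that [p] divides [y]. *)
Lemma bezout_irreducible_prime p x y :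
  irreducible_in D p -> D x -> D y -> (exists2 c, D c & x * y = c * p) ->
  (exists2 c, D c & x = c * p) \/ (exists2 c, D c & y = c * p).
Proof.
move=> [Dp /eqP p0 _ pI] Dx Dy [k Dk xyE].
have [g [c [d [a [b [[Dc Dd Da Db] [Dg pE xE gE]]]]]]] := bezout_gcd p0 Dp Dx.
have [[_ [c' Dc' cc']]|[_ [g' Dg' gg']]] := pI c g Dc Dg pE.
  left; exists (d * c'); first exact: subringM.
  by rewrite pE xE -[in LHS](mul1r g) -cc'; ring.
right; exists (g' * (a * y + b * k)); first by subring hD.
rewrite -[LHS]mul1r -gg' [in LHS]gE.
transitivity (g' * (a * p * y + b * (x * y))); first by ring.
by rewrite xyE; ring.
Qed.

(** Unique factorization, in the form needed here: a divisor [g] of a product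
    of irreducibles is associated to a subproduct, which is shorter unless the
    cofactor [v] is a unit. *)
Lemma bezout_divisor_prod (s : seq F) v g :
  [set` s] `<=` irreducible_in D -> D v -> D g -> v * g = \prod_(a <- s) a ->
  unit_in D v \/
  exists s' e, [/\ [set` s'] `<=` irreducible_in D, (size s' < size s)%N,
    unit_in D e & g * e = \prod_(a <- s') a].
Proof.
elim: s v g => [|p s IHs] v g sI Dv Dg.
  by rewrite big_nil => vg; left; split=> //; exists g.
rewrite big_cons => vgE.
have pI : irreducible_in D p by apply: sI; rewrite /= mem_head.
have {}sI : [set` s] `<=` irreducible_in D.
  by move=> a /= sa; apply: sI; rewrite /= in_cons sa orbT.
have Dprod : D (\prod_(a <- s) a).
  by apply: (subring_prod hD) => a /sI [].
have /eqP p0 : p <> 0 by case: pI.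
have [|[v' Dv' vE]|[g' Dg' gE]] := bezout_irreducible_prime pI Dv Dg.
- by exists (\prod_(a <- s) a) => //; rewrite vgE mulrC.
- have v'gE : v' * g = \prod_(a <- s) a.
    by apply: (mulfI p0); rewrite -vgE vE; ring.
  have [uv'|[s' [e [s'I ss' ue geE]]]] := IHs _ _ sI Dv' Dg v'gE; right.
    by exists s, v'; split=> //=; rewrite mulrC.
  by exists s', e; split=> //=; apply: ltnW.
- have vg'E : v * g' = \prod_(a <- s) a.
    by apply: (mulfI p0); rewrite -vgE gE; ring.
  have [uv|[s' [e [s'I ss' ue geE]]]] := IHs _ _ sI Dv Dg' vg'E; first by left.
  right; exists (p :: s'), e; split=> //.
    by move=> a /=; rewrite in_cons => /orP[/eqP -> //|/s'I].
  by rewrite big_cons -geE gE; ring.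
Qed.

Hypothesis atomicD : atomic D.

(** A shortest product of irreducibles in [I] generates [I]: its gcd with
    another element of [I] is again in [I], hence cannot be shorter. *)
Lemma bezout_atomic_principal I m : is_ideal D I -> I m -> m != 0 ->
  exists2 g, I g & forall x, I x -> exists2 a, D a & x = a * g.
Proof.
move=> [ID _ Iadd Imul] Im m0; have Dm := ID _ Im.
case: (pselect (unit_in D m)) => [[_ [m' Dm' mm']]|mU].
  exists m => // x Ix; exists (x * m'); first by apply: subringM => //; apply: ID.
  by rewrite -mulrA [m' * m]mulrC mm' mulr1.
pose P n := `[< exists s, [/\ [set` s] `<=` irreducible_in D, size s = n & I (\prod_(a <- s) a)] >].
have exP : exists n, P n.
  have [s sI mE] := atomicD Dm (elimN eqP m0) mU.
  by exists (size s); apply/asboolP; exists s; rewrite -mE.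
have [n /asboolP [s [sI sn Is]] nmin] := find_ex_minn exP.
exists (\prod_(a <- s) a) => // x Ix.
have s0 : \prod_(a <- s) a != 0.
  rewrite prodf_seq_neq0; apply/allP => a /sI [_ /eqP] //.
have [g [c [d [a [b [[Dc Dd Da Db] [Dg sE xE gE]]]]]]] := bezout_gcd s0 (ID _ Is) (ID _ Ix).
have Ig : I g by rewrite gE; apply: Iadd; apply: Imul.
have [[_ [c' Dc' cc']]|[s' [e [s'I ss' [De _] geE]]]] := bezout_divisor_prod sI Dc Dg (esym sE).
  exists (d * c'); first exact: subringM.
  by rewrite sE xE -[in LHS](mul1r g) -cc'; ring.
have /nmin : P (size s').
  by apply/asboolP; exists s'; split=> //; rewrite -geE mulrC; apply: Imul.
by rewrite leqNgt -sn ss'.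
Qed.

End BezoutAtomic.

(** * Localization at the elements prime to a modulus *)

Section Localization.
Variables (F : fieldType) (O : set F) (m : F).
Hypothesis hO : is_subring O.
Hypothesis prO : prufer O.
Hypothesis idO : idempotent_powers O.
Hypotheses (Om : O m) (m0 : m != 0).

Definition prime_to : set F :=
  [set s | O s /\ exists u v, [/\ O u, O v & u * s = 1 + m * v]].

(** Inverting the units modulo [m] makes every [1 + m * z] invertible and leaves
    the residue ring modulo [m] unchanged. *)
Definition localized : set F := [set y | exists2 s, prime_to s & O (s * y)].

Lemma prime_to1 : prime_to 1.
Proof.
split; first exact: subring1.
by exists 1, 0; rewrite !mulr0 addr0 mulr1; split=> //; [exact: subring1|exact: subring0].
Qed.

Lemma prime_toM s t : prime_to s -> prime_to t -> prime_to (s * t).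
Proof.
move=> [Os [u [v [Ou Ov us]]]] [Ot [u' [v' [Ou' Ov' ut]]]]; split; first exact: subringM.
exists (u * u'), (v + v' + m * v * v'); split; subring hO.
by rewrite mulrACA us ut; ring.
Qed.

Lemma sub_localized : O `<=` localized.
Proof. by move=> y Oy; exists 1; rewrite ?mul1r //; exact: prime_to1. Qed.

Lemma localized_subring : is_subring localized.
Proof.
split=> [|x y|x y].
- by apply: mem_set; apply: sub_localized; exact: subring1.
- move=> /set_mem [s Ss Osx] /set_mem [t St Oty]; apply: mem_set.
  exists (s * t); first exact: prime_toM.
  have -> : s * t * (x - y) = t * (s * x) - s * (t * y) by ring.
  by case: Ss St => Os _ [Ot _]; subring hO.
- move=> /set_mem [s Ss Osx] /set_mem [t St Oty]; apply: mem_set.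
  exists (s * t); first exact: prime_toM.
  by rewrite mulrACA; apply: subringM.
Qed.
Let hD := localized_subring.

Hypothesis mN : forall v, O v -> m * v <> 1.

Lemma prime_to_neq0 s : prime_to s -> s != 0.
Proof.
move=> [_ [u [v [_ Ov]]]]; apply: contra_eqN => /eqP ->; rewrite mulr0 eq_sym addrC.
apply/eqP => h; apply: (@mN (- v)); first exact: subringN.
by rewrite mulrN; apply/eqP; rewrite eqr_oppLR -addr_eq0 h.
Qed.

Lemma localized_unit z : localized z -> 1 + m * z != 0 /\ localized (1 + m * z)^-1.
Proof.
move=> [s Ss Osz].
have Sw : prime_to (s + m * (s * z)).
  have [Os [u [v [Ou Ov us]]]] := Ss; split; first by subring hO.
  exists u, (v + u * (s * z)); split=> //; subring hO.
  by rewrite mulrDr us; ring.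
have wE : s + m * (s * z) = s * (1 + m * z) by ring.
have nz : 1 + m * z != 0.
  by have := prime_to_neq0 Sw; rewrite wE mulf_eq0 negb_or => /andP[].
split=> //; exists (s + m * (s * z)) => //.
by rewrite wE mulfK //; case: Ss.
Qed.

(** The two candidates [l] and [l'] for a generator of the inverse of the
    fractional ideal generated by [1] and [t] are glued along the element
    [e = l ^+ N], which is idempotent modulo [m]. *)
Lemma localized_bezout : bezout localized.
Proof.
move=> t; have [l [l' [Ol Ol' Olt Ol't llE]]] := prO t.
have [N [z [N0 Oz]]] := idO Om m0 Ol.
set e := l ^+ N => eE.
pose v := e * l + (1 - e) * l'; pose G := \sum_(i < N) l ^+ i.
have OG : O G by apply: subring_sum => // i _; apply: subringX.
have GE : G * (1 - l) = 1 - e by rewrite -[1 - e]opprB subrX1 -/G; ring.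
have Oe : O e by apply: subringX.
have lE : l ^+ N.-1 * l = e by rewrite -exprSr prednK.
pose w := l ^+ N.-1 * l' + G * (l * t) - 3%:R.
have Ow : O w by rewrite /w; subring hO.
have Dzw : localized (z * w) by apply: sub_localized; subring hO.
have [nz DV] := localized_unit Dzw.
set u := 1 + m * (z * w) in nz DV.
have uE : l ^+ N.-1 * e * v + (1 - e) * G * (v * t) = u.
  have -> : u = 1 + (e - e ^+ 2) * w by rewrite /u eE mulrA.
  transitivity (e * (l ^+ N.-1 * l) * e + l ^+ N.-1 * (e - e ^+ 2) * l'
     + G * (e - e ^+ 2) * (l * t) + (1 - e) ^+ 2 * (G * (l' * t))).
    by rewrite /v; ring.
  have -> : l' * t = 1 - l by rewrite -llE; ring.
  by rewrite lE GE /w; ring.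
exists v, (l ^+ N.-1 * e / u), ((1 - e) * G / u); split.
- by apply: sub_localized; rewrite /v; subring hO.
- apply: sub_localized; have -> : v * t = e * (l * t) + (1 - e) * (l' * t) by rewrite /v; ring.
  by subring hO.
- by apply: (subringM hD) => //; apply: sub_localized; subring hO.
- by apply: (subringM hD) => //; apply: sub_localized; subring hO.
- by rewrite mulrAC [_ / u * _]mulrAC -mulrDl uE mulfV.
Qed.

(** The generator [d] of the extension of [I] may be multiplied by an element
    prime to [m] so that it lies in [I]; then [I] is generated by [d] and [m]. *)
Lemma ideal_two_generators I : atomic localized -> is_ideal O I -> I m ->
  exists2 d, I d & forall y, I y -> exists a b, [/\ O a, O b & y = a * d + b * m].
Proof.
move=> atD [IO I0 Iadd Imul] Im.
pose J : set F := [set y | exists2 s, prime_to s & I (s * y)].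
have idJ : is_ideal localized J.
  split.
  - by move=> y [s Ss Isy]; exists s => //; apply: IO.
  - by exists 1; [exact: prime_to1|rewrite mulr0].
  - move=> x y [s Ss Isx] [t St Ity]; exists (s * t); first exact: prime_toM.
    have -> : s * t * (x + y) = t * (s * x) + s * (t * y) by ring.
    by case: Ss St => Os _ [Ot _]; apply: Iadd; apply: Imul.
  - move=> a x [s Ss Osa] [t St Itx]; exists (s * t); first exact: prime_toM.
    by rewrite mulrACA; apply: Imul.
have Jm : J m by exists 1; rewrite ?mul1r //; exact: prime_to1.
have [d [s Ss Isd] dP] := bezout_atomic_principal hD localized_bezout atD idJ Jm m0.
exists (s * d) => // y Iy.
have [z [t St Otz] yE] : exists2 a, localized a & y = a * d.
  by apply: dP; exists 1; [exact: prime_to1|rewrite mul1r].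
have [_ [u [v [Ou Ov us]]]] := prime_toM Ss St.
exists (u * (t * z)), (- (v * y)); split; first exact: subringM.
  by apply: (subringN hO); apply: (subringM hO) => //; apply: IO.
transitivity (u * (s * t) * y - m * v * y); first by rewrite us; ring.
by rewrite {1}yE; ring.
Qed.

End Localization.

Section AtomicNoetherian.
Variables (F : fieldType) (O : set F).
Hypothesis hO : is_subring O.
Hypothesis idO : idempotent_powers O.

(** An ideal containing a nonzero nonunit [m] is generated by [m] and one more
    element, by atomicity of the localization at [m]. *)
Lemma atomic_prufer_noetherian :
  prufer O -> hereditarily_atomic [set: F] -> noetherian O.
Proof.
move=> prO atF I idI; have [IO I0 Iadd Imul] := idI.
have [[m Im m0]|] := pselect (exists2 m, I m & m != 0); last first.
  move=> h; exists [::] => //; apply/seteqP; split=> x; last first.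
    by move=> /(_ I); apply; split=> // ? .
  by move=> Ix; have [->|x0] := eqVneq x 0; [move=> J [[]]|case: h; exists x].
have Om := IO _ Im.
suff [s sI sP] : exists2 s : seq F, [set` s] `<=` I &
    forall J, is_ideal O J -> [set` s] `<=` J -> I `<=` J.
  exists s => //; apply/seteqP; split; last exact: smallest_sub.
  by move=> y Iy J [idJ sJ]; apply: (sP J).
have [[v Ov mv]|mN] := pselect (exists2 v, O v & m * v = 1).
  exists [:: m] => [x /=|J [_ _ _ JM] sJ y Iy]; first by rewrite inE => /eqP ->.
  have -> : y = y * v * m by rewrite -mulrA [v * m]mulrC mv mulr1.
  by apply: JM; [apply: subringM => //; apply: IO|apply: sJ; rewrite /= mem_head].
have mN' v : O v -> m * v <> 1 by move=> Ov h; case: mN; exists v.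
have atD : atomic (localized O m) by apply: atF => //; apply: localized_subring.
have [d Id dP] := ideal_two_generators hO prO idO Om m0 mN' atD idI Im.
exists [:: d; m] => [x /=|J [_ _ JD JM] sJ y Iy].
  by rewrite !inE => /orP[] /eqP ->.
have [a [b [Oa Ob ->]]] := dP y Iy.
by apply: JD; apply: JM => //; apply: sJ; rewrite /= !inE eqxx ?orbT.
Qed.

(** If [a] is outside [P], an idempotent power [a ^+ N] modulo a nonzero element
    of [P] satisfies [a ^+ N * (1 - a ^+ N)] in [P], so [1] is in [P + (a)]. *)
Lemma idempotent_powers_prime_maximal P :
  prime_ideal O P -> P <> [set 0] -> maximal_ideal O P.
Proof.
move=> [idP PO Pprime] P0; have [PsubO Pz Padd Pmul] := idP; split=> // J [JO _ Jadd Jmul] PJ.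
have [JP|] := pselect (J `<=` P); first by left; apply/seteqP.
move=> /existsNP [a /not_implyP [Ja Pa]]; right; apply/seteqP; split=> // x Ox.
have [m Pm m0] : exists2 m, P m & m != 0.
  apply: contrapT => h; apply: P0; apply/seteqP; split=> y; last by move=> ->.
  by move=> Py; apply: contrapT => /eqP y0; apply: h; exists y.
have Oa := JO _ Ja.
have [N [z [N0 Oz E]]] := idO (PsubO _ Pm) m0 Oa.
have OaN : O (a ^+ N) by exact: subringX.
have O1aN : O (1 - a ^+ N) by apply: subringB => //; exact: subring1.
have PaN k : P (a ^+ k) -> P a.
  elim: k => [|k IHk]; rewrite ?expr0 ?exprS => h.
    by case: PO; apply/seteqP; split=> // y Oy; rewrite -[y]mulr1; apply: Pmul.
  by case: (Pprime _ _ Oa (subringX hO k Oa) h).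
have J1 : J 1.
  have [/PaN //|Pb] : P (a ^+ N) \/ P (1 - a ^+ N).
    apply: Pprime => //; have -> : a ^+ N * (1 - a ^+ N) = z * m.
      by rewrite mulrC -[RHS]mulrC -E; ring.
    exact: Pmul.
  have -> : 1 = (1 - a ^+ N) + a ^+ N.-1 * a :> F by rewrite -exprSr prednK // subrK.
  by apply: Jadd; [exact: PJ|apply: Jmul => //; exact: subringX].
by rewrite -[x]mulr1; apply: Jmul.
Qed.

End AtomicNoetherian.

(** * Descent of the ascending chain condition on principal ideals *)

Definition factors_in (F : fieldType) (R : set F) (x : F) :=
  exists2 s : seq F, [set` s] `<=` irreducible_in R & x = \prod_(a <- s) a.

Definition unfactorable (F : fieldType) (R : set F) (x : F) :=
  [/\ R x, x <> 0, ~ unit_in R x & ~ factors_in R x].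

Lemma unfactorable_step (F : fieldType) (R : set F) (x : F) :
  unfactorable R x -> exists y b, [/\ unfactorable R y, R b, ~ unit_in R b & x = b * y].
Proof.
move=> [Rx x0 xU xF].
have [a [b [Ra Rb xE aU bU]]] : exists a b,
    [/\ R a, R b, x = a * b, ~ unit_in R a & ~ unit_in R b].
  apply: contrapT => h; apply: xF; exists [:: x]; last by rewrite big_seq1.
  move=> y /=; rewrite inE => /eqP ->; split=> // a b Ra Rb xE.
  apply: contrapT => /not_orP [aU bU]; apply: h.
  by exists a, b.
have a0 : a <> 0 by move=> a0; apply: x0; rewrite xE a0 mul0r.
have b0 : b <> 0 by move=> b0; apply: x0; rewrite xE b0 mulr0.
have [[s sI sE]|aF] := pselect (factors_in R a); last first.
  by exists a, b; split=> //; rewrite mulrC.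
have [[t tI tE]|bF] := pselect (factors_in R b); last by exists b, a.
case: xF; exists (s ++ t); last by rewrite big_cat /= -sE -tE.
by move=> y /=; rewrite mem_cat => /orP[]; [exact: sI|exact: tI].
Qed.

(** An unfactorable element of [R] starts a chain of proper divisors.  The
    ideals they generate in the integral closure [T] of [R] are determined by
    their traces on [O], so the chain becomes stationary in [T]; a quotient of
    consecutive terms is then a unit of [T], hence of [R]. *)
Lemma noetherian_prufer_atomic (F : fieldType) (O R : set F) :
  is_subring O -> noetherian O -> prufer O -> is_subring R ->
  (forall x, O x -> integral_over R x) -> atomic R.
Proof.
move=> hO noethO prO hR OR x Rx x0 xU; apply: contrapT => xF.
pose T := integral_closure R [set: F].
have hT : is_subring T := integral_closure_subring hR.
have RT : R `<=` T := sub_integral_closure hR.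
have OT : O `<=` T by move=> y Oy; split=> //; exact: OR.
have /choice [g gP] y : exists y', unfactorable R y ->
    unfactorable R y' /\ exists b, [/\ R b, ~ unit_in R b & y = b * y'].
  have [yb|yb] := pselect (unfactorable R y); last by exists 0.
  by have [y' [b [? ? ? ?]]] := unfactorable_step yb; exists y'; split=> //; exists b.
pose f n := iter n g x.
have fbad n : unfactorable R (f n).
  by elim: n => [|n IHn]; [split|have [] := gP _ IHn].
have Rf n : R (f n) by case: (fbad n).
have fS n : exists b, [/\ R b, ~ unit_in R b & f n = b * f n.+1].
  by have [_] := gP _ (fbad n).
have fD n k : exists2 c, R c & f n = c * f (k + n)%N.
  elim: k => [|k [c Rc cE]]; first by exists 1; rewrite ?mul1r //; exact: subring1.
  have [b [Rb _ bE]] := fS (k + n)%N.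
  by exists (c * b); [exact: subringM|rewrite cE bE mulrA].
pose J n : set F := [set y | O y /\ exists2 c, T c & y = c * f n].
have J_le n k : (n <= k)%N -> J n `<=` J k.
  move=> nk y [Oy [c Tc yE]]; split=> //; have [d Rd] := fD n (k - n)%N.
  rewrite subnK // => dE; exists (c * d); last by rewrite yE dE mulrA.
  by apply: subringM => //; apply: RT.
have idJ n : is_ideal O (J n).
  split.
  - by move=> y [].
  - by split; [exact: subring0|exists 0; [exact: subring0|rewrite mul0r]].
  - move=> y z [Oy [c Tc yE]] [Oz [d Td zE]]; split; first exact: subringD.
    by exists (c + d); [exact: subringD|rewrite mulrDl -yE -zE].
  - move=> a y Oa [Oy [c Tc yE]]; split; first exact: subringM.
    by exists (a * c); [apply: subringM => //; apply: OT|rewrite -mulrA -yE].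
have idU : is_ideal O (\bigcup_n J n).
  split.
  - by move=> y [n _ []].
  - by exists 0 => //; case: (idJ 0).
  - move=> y z [n _ Jy] [k _ Jz]; exists (maxn n k) => //.
    case: (idJ (maxn n k)) => _ _ + _.
    by apply; [apply: J_le Jy|apply: J_le Jz]; rewrite ?leq_maxl ?leq_maxr.
  - by move=> a y Oa [n _ Jy]; exists n => //; case: (idJ n) => _ _ _; apply.
have [s sU UE] := noethO _ idU.
have [n sJ] : exists n, [set` s] `<=` J n.
  elim: s sU {UE} => [|a s IHs] sU; first by exists 0%N.
  have [|n sJ] := IHs; first by move=> y /= ys; apply: sU; rewrite /= in_cons ys orbT.
  have [k _ Ja] := sU a (mem_head _ _); exists (maxn n k) => y /=.
  rewrite in_cons => /orP[/eqP ->|/sJ]; first by apply: J_le Ja; rewrite leq_maxr.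
  by apply: J_le; rewrite leq_maxl.
have UJ k : J k `<=` J n.
  move=> y Jy; have : (\bigcup_n J n) y by exists k.
  by rewrite UE; apply.
have [b [Rb bU bE]] := fS n.
have [l [l' [Ol Ol' Oly Ol'y lE]]] := prO (f n.+1).
have [_ [c Tc cE]] : J n (l * f n.+1).
  by apply: (UJ n.+1); split=> //; exists l => //; apply: OT.
have [_ [d Td dE]] : J n (l' * f n.+1).
  by apply: (UJ n.+1); split=> //; exists l' => //; apply: OT.
have /eqP fn0 : f n.+1 <> 0 by case: (fbad n.+1).
have bV : (c + d * f n.+1) * b = 1.
  apply: (mulIf fn0); rewrite mul1r -mulrA -bE mulrDl -cE mulrAC -dE.
  by rewrite -[RHS]mul1r -lE; ring.
have b0 : b != 0 by apply: contra_eq_neq bV => ->; rewrite mulr0 eq_sym oner_neq0.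
have bVE : b^-1 = c + d * f n.+1 by apply: (mulIf b0); rewrite bV mulVf.
apply: bU; split=> //; exists b^-1; last exact: mulfV.
apply: integral_inv_mem => //; rewrite bVE.
have [] // : T (c + d * f n.+1).
by apply: subringD => //; apply: subringM => //; apply: RT.
Qed.

(** * Non-atomic rings of polynomial values *)

Section NonAtomic.
Variables (F : fieldType) (A : set F) (c y : F).
Hypothesis hA : is_subring A.
Hypotheses (Ac : A c) (c0 : c != 0) (cV : ~ A c^-1).
Hypothesis yA : ~ algebraic_over A y.

(** The ring [A + y A[1/c][y]]. *)
Definition constant_term_ring : set F :=
  [set z | exists f : {poly F}, [/\ A f`_0, exists k, forall i, A (c ^+ k * f`_i) & z = f.[y]]].
Local Notation N := constant_term_ring.

(** Elements of the ring have well defined polynomials, as [y] is transcendental. *)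
Lemma transcendental_eq (f g : {poly F}) :
  (exists k, forall i, A (c ^+ k * f`_i)) -> (exists k, forall i, A (c ^+ k * g`_i)) ->
  f.[y] = g.[y] -> f = g.
Proof.
move=> [k fA] [l gA] fg; apply/eqP; rewrite -subr_eq0; apply: contra_notT yA => h.
apply/(algebraic_over_coef hA); exists (c ^+ (k + l) *: (f - g)); split.
- by rewrite scaler_eq0 expf_eq0 (negPf c0) andbF.
- move=> i; rewrite coefZ coefB.
  have -> : c ^+ (k + l) * (f`_i - g`_i) = c ^+ l * (c ^+ k * f`_i) - c ^+ k * (c ^+ l * g`_i).
    by rewrite exprD; ring.
  by subring hA.
- by rewrite hornerZ hornerD hornerN fg subrr mulr0.
Qed.

Lemma constant_term_ring_subring : is_subring N.
Proof.
split=> [|z w|z w].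
- apply: mem_set; exists 1; rewrite hornerC coef1; split=> //; first exact: subring1.
  by exists 0%N => i; rewrite mul1r coef1; apply: (subring_nat hA).
- move=> /set_mem [f [f0 [k fA] ->]] /set_mem [g [g0 [l gA] ->]]; apply: mem_set.
  exists (f - g); rewrite hornerD hornerN coefB; split=> //; first by subring hA.
  exists (k + l)%N => i; rewrite coefB.
  have -> : c ^+ (k + l) * (f`_i - g`_i) = c ^+ l * (c ^+ k * f`_i) - c ^+ k * (c ^+ l * g`_i).
    by rewrite exprD; ring.
  by subring hA.
- move=> /set_mem [f [f0 [k fA] ->]] /set_mem [g [g0 [l gA] ->]]; apply: mem_set.
  exists (f * g); rewrite hornerM coef0M; split=> //; first by subring hA.
  exists (k + l)%N => i; rewrite coefM mulr_sumr; apply: (subring_sum hA) => j _.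
  by rewrite exprD mulrACA; subring hA.
Qed.
Let hN := constant_term_ring_subring.

Lemma constant_term_sub : A `<=` N.
Proof.
move=> a Aa; exists a%:P; rewrite hornerC coefC; split=> //.
exists 0%N => i; rewrite mul1r coefC; case: ifP => // _; exact: subring0.
Qed.

Lemma zero_constant_term_nonunit (f : {poly F}) :
  f`_0 = 0 -> (exists k, forall i, A (c ^+ k * f`_i)) -> ~ unit_in N f.[y].
Proof.
move=> f0 [k fA] [_ [_ [g [_ [l gA] ->]]]]; rewrite -hornerM -[1](hornerC 1 y).
move=> /transcendental_eq fg.
have : (f * g)`_0 = (1 : {poly F})`_0.
  rewrite fg //; last first.
    by exists 0%N => i; rewrite mul1r coefC; case: ifP => _; [exact: subring1|exact: subring0].
  exists (k + l)%N => i; rewrite coefM mulr_sumr; apply: (subring_sum hA) => j _.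
  by rewrite exprD mulrACA; subring hA.
by rewrite coef0M f0 mul0r coef1 => /eqP; rewrite eq_sym oner_eq0.
Qed.

(** Among factors of [y] one has zero constant term.  It is divisible by [c],
    which is not a unit, and the quotient has zero constant term as well. *)
Lemma constant_term_ring_not_atomic : ~ atomic N.
Proof.
have A1 := subring1 hA.
have XA : exists k, forall i, A (c ^+ k * ('X : {poly F})`_i).
  by exists 0%N => i; rewrite mul1r coefX; apply: (subring_nat hA).
move=> atN.
have [|||s sI] := atN y.
- by exists 'X; rewrite hornerX coefX; split=> //; exact: subring0.
- move=> y0; apply: yA; apply/(algebraic_over_coef hA); exists 'X.
  by rewrite polyX_eq0 hornerX; split=> // i; rewrite coefX; apply: (subring_nat hA).
- by rewrite -[y in unit_in _ y]hornerX; apply: zero_constant_term_nonunit => //; rewrite coefX.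
suff key : forall s : seq F, [set` s] `<=` irreducible_in N ->
    exists f : {poly F}, [/\ f`_0 != 0, exists k, forall i, A (c ^+ k * f`_i)
      & \prod_(a <- s) a = f.[y]].
  have [f [f0 fA ->]] := key s sI; rewrite -{1}[y]hornerX => /transcendental_eq Xf.
  by move: f0; rewrite -Xf // coefX eqxx.
elim=> [|a {}s IHs] {}sI.
  exists 1; rewrite coef1 oner_neq0 big_nil hornerC; split=> //.
  by exists 0%N => i; rewrite mul1r coef1; apply: (subring_nat hA).
have [|f [f0 [k fA] fE]] := IHs.
  by move=> b /= sb; apply: sI; rewrite /= in_cons sb orbT.
have [Na a0 aU aI] := sI a (mem_head _ _); have [g [Ag [l gA] gE]] := Na.
exists (g * f); rewrite coef0M big_cons fE gE hornerM; split=> //; last first.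
  exists (l + k)%N => i; rewrite coefM mulr_sumr; apply: (subring_sum hA) => j _.
  by rewrite exprD mulrACA; subring hA.
rewrite mulf_neq0 //; apply/eqP => g0.
have hA' : exists k, forall i, A (c ^+ k * (c^-1 *: g)`_i).
  by exists l.+1 => i; rewrite coefZ exprSr -mulrA mulVKf.
have h0 : (c^-1 *: g)`_0 = 0 by rewrite coefZ g0 mulr0.
have [||| [_ [_ [h [Ah [j hA2] ->]] E]]|] := aI c (c^-1 *: g).[y].
- exact: constant_term_sub.
- by exists (c^-1 *: g); split=> //; rewrite h0; exact: subring0.
- by rewrite gE hornerZ mulVKf.
- apply: cV.
  have ch1 : c *: h = 1.
    apply: transcendental_eq; last by rewrite hornerZ E hornerC.
      by exists j => i; rewrite coefZ mulrCA; apply: subringM.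
    by exists 0%N => i; rewrite mul1r coef1; apply: (subring_nat hA).
  have : (c *: h)`_0 = 1 by rewrite ch1 coef1.
  rewrite coefZ => ch; have -> // : c^-1 = h`_0.
  by apply: (mulfI c0); rewrite ch mulfV.
- exact: zero_constant_term_nonunit.
Qed.

Lemma transcendental_not_hereditarily_atomic : ~ hereditarily_atomic [set: F].
Proof. by move=> /(_ _ hN (@subsetT _ _)); apply: constant_term_ring_not_atomic. Qed.

End NonAtomic.

(** * The ring of integers and polynomial rings over a finite field *)

Section PrimeSubring.
Variable F : fieldType.
Local Notation Z := (prime_subring F).
Let hZ := prime_subringP F.

Lemma prime_subring_pid : is_pid Z.
Proof.
split=> // I [IZ I0 Iadd Imul].
have Z1 n : Z n%:~R by exists n.
have [h|/existsNP [x /not_implyP [Ix /eqP x0]]] := pselect (forall x, I x -> x = 0).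
  by exists 0 => // x /h ->; exists 0; [exact: subring0|rewrite mul0r].
have /choice [r rP] x' : exists n : int, Z x' -> x' = n%:~R.
  by have [[n _ <-]|nZ] := pselect (Z x'); [exists n|exists 0].
pose P n := `[< I n%:R /\ n%:R != 0 :> F >].
have exP : exists n, P n.
  case: (r x) (rP x (IZ _ Ix)) => n xE.
    by exists n; apply/asboolP; rewrite -[n%:R]/(n%:~R) -xE.
  exists n.+1; apply/asboolP; have -> : n.+1%:R = -1 * x.
    by rewrite xE NegzE rmorphN /= mulN1r opprK.
  rewrite mulf_neq0 ?oppr_eq0 ?oner_neq0 //; split=> //; apply: Imul => //.
  by apply: (subringN hZ); exact: subring1.
have [k /asboolP [Ik k0] kmin] := find_ex_minn exP.
exists k%:R => // y Iy; have yE := rP y (IZ _ Iy).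
have kZ : Posz k != 0 by apply: contra_neq k0 => -[->].
exists (r y %/ k)%Z%:~R => //.
have yE' : y = (r y %/ k)%Z%:~R * k%:R + (r y %% k)%Z%:~R.
  by rewrite {1}yE {1}(divz_eq (r y) k) rmorphD rmorphM.
case E: (r y %% k)%Z (modz_ge0 (r y) kZ) (ltz_mod (r y) kZ) yE' => [j|//] _ jk yE'.
suff j0 : j%:R = 0 :> F by rewrite {1}yE' -[(Posz j)%:~R]/(j%:R) j0 addr0.
apply: contrapT => /eqP j0; move: jk; rewrite /= ltz_nat ltnNge kmin //.
apply/asboolP; split=> //.
have -> : j%:R = y + (- (r y %/ k)%Z)%:~R * k%:R :> F.
  by rewrite {1}yE' rmorphN -[(Posz j)%:~R]/(j%:R); ring.
by apply: Iadd => //; apply: Imul.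
Qed.

(** Colour an integer by its residue modulo the given nonzero one. *)
Lemma prime_subring_finite_residues : finite_residues Z.
Proof.
have /choice [r rP] x : exists n : int, Z x -> x = n%:~R.
  by have [[n _ <-]|nZ] := pselect (Z x); [exists n|exists 0].
move=> _ [n _ <-] n0; have {}n0 : n != 0 by apply: contra_neq n0 => ->.
exists 'I_`|n|.+1, (fun x => inord `|(r x %% n)%Z|%N) => a b Za Zb.
have lt_mod z : (`|(z %% n)%Z|%N < `|n|.+1)%N.
  by rewrite ltnS -lez_nat !abszE ger0_norm ?modz_ge0 // ltW // ltz_mod.
move=> /(congr1 val) /=; rewrite !inordK // => /(congr1 Posz).
rewrite !abszE !ger0_norm ?modz_ge0 // => rab.
exists ((r a %/ n)%Z - (r b %/ n)%Z)%:~R; first by exists ((r a %/ n)%Z - (r b %/ n)%Z).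
rewrite {1}(rP a Za) {1}(rP b Zb) -rmorphB -rmorphM /=; congr (_%:~R).
by rewrite [r a in LHS](divz_eq (r a) n) [r b in LHS](divz_eq (r b) n) rab; ring.
Qed.

End PrimeSubring.

Definition finite_coloring (F : fieldType) (K : set F) :=
  exists (T : finType) (c : F -> T), forall a b, K a -> K b -> c a = c b -> a = b.

Lemma prime_subring_finite (F : fieldType) p :
  p \in [pchar F] -> finite_coloring (prime_subring F).
Proof.
move=> pF; have /choice [r rP] x : exists n : int, prime_subring F x -> x = n%:~R.
  by have [[n _ <-]|nZ] := pselect (prime_subring F x); [exists n|exists 0].
have p0 : Posz p != 0 by rewrite -lt0n prime_gt0 // (pcharf_prime pF).
exists 'I_p.+1, (fun x => inord `|(r x %% p)%Z|%N) => a b Za Zb.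
have lt_mod z : (`|(z %% p)%Z|%N < p.+1)%N.
  by rewrite ltnS -lez_nat abszE ger0_norm ?modz_ge0 // ltW // (ltz_mod z p0).
move=> /(congr1 val) /=; rewrite !inordK // => /(congr1 Posz).
rewrite !abszE !ger0_norm ?modz_ge0 // => rab.
rewrite (rP a Za) (rP b Zb) (divz_eq (r a) p) (divz_eq (r b) p) rab.
by rewrite !rmorphD !rmorphM /= -[p%:~R]/(p%:R) (pcharf0 pF) !mulr0.
Qed.

(** Two powers of a nonzero element coincide, so its inverse is a power. *)
Lemma finite_subring_subfield (F : fieldType) (K : set F) :
  is_subring K -> finite_coloring K -> is_subfield K.
Proof.
move=> hK [T [c cP]]; apply: subring_subfield => // x Kx x0.
have [i [j [ij /cP]]] := pigeonhole_nat (fun i => c (x ^+ i)).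
move=> /(_ (subringX hK i Kx) (subringX hK j Kx)) xij.
have -> : x^-1 = x ^+ (j - i.+1).
  apply: (mulfI x0); rewrite mulfV // -exprS subnSK //.
  by apply: (mulfI (expf_neq0 i x0)); rewrite mulr1 -exprD subnKC // ltnW.
exact: subringX.
Qed.

Section PolynomialRing.
Variables (F : fieldType) (K : set F) (x : F).
Hypothesis hK : is_subring K.
Local Notation Kx := (generated_subring (K `|` [set x])).

Lemma generated_subringP : is_subring Kx.
Proof.
split=> [|y z|y z].
- by apply: mem_set => I [hI _]; apply: subring1.
- move=> /set_mem Ky /set_mem Kz; apply: mem_set => I [hI sI].
  by apply: subringB => //; [apply: Ky|apply: Kz].
- move=> /set_mem Ky /set_mem Kz; apply: mem_set => I [hI sI].
  by apply: subringM => //; [apply: Ky|apply: Kz].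
Qed.

Lemma sub_generated_subring : K `<=` Kx.
Proof. by move=> a Ka; apply: sub_gen_smallest; left. Qed.

Lemma mem_generated_subring : Kx x.
Proof. by apply: sub_gen_smallest; right. Qed.

Lemma generated_subring_poly y :
  Kx y <-> exists2 p : {poly F}, forall i, K p`_i & y = p.[x].
Proof.
split=> [|[p pK ->]]; last first.
  apply: (subring_horner generated_subringP); last exact: mem_generated_subring.
  by move=> i; apply: sub_generated_subring.
move=> Ky; apply: (Ky [set z | exists2 p : {poly F}, forall i, K p`_i & z = p.[x]]).
split=> [|a].
  split=> [|a b|a b].
  - apply: mem_set; exists 1; last by rewrite hornerC.
    by move=> i; rewrite coef1; apply: (subring_nat hK).
  - move=> /set_mem [p pK ->] /set_mem [q qK ->]; apply: mem_set.
    exists (p - q); last by rewrite hornerD hornerN.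
    by move=> i; rewrite coefB; apply: subringB.
  - move=> /set_mem [p pK ->] /set_mem [q qK ->]; apply: mem_set.
    by exists (p * q); [exact: subring_coefM|rewrite hornerM].
move=> [Ka|/= ->].
  exists a%:P; last by rewrite hornerC.
  by move=> i; rewrite coefC; case: ifP => // _; exact: subring0.
by exists 'X; [move=> i; rewrite coefX; apply: (subring_nat hK)|rewrite hornerX].
Qed.

Lemma transcendental_inv_notin : ~ algebraic_over K x -> x != 0 /\ ~ Kx x^-1.
Proof.
move=> xK; have x0 : x != 0.
  apply/eqP => x0; apply: xK; apply/(algebraic_over_coef hK); exists 'X.
  by rewrite polyX_eq0 hornerX; split=> // i; rewrite coefX; apply: (subring_nat hK).
split=> // /generated_subring_poly [p pK xE]; apply: xK.
apply/(algebraic_over_coef hK); exists (p * 'X - 1); split.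
- apply/eqP => /(congr1 (fun q : {poly F} => q`_0)); rewrite coefB coefMX coef1 coef0 sub0r.
  by move/eqP; rewrite oppr_eq0 oner_eq0.
- move=> i; rewrite coefB coefMX coef1; apply: subringB => //; last exact: (subring_nat hK).
  by case: ifP => // _; exact: subring0.
- by rewrite hornerD hornerN hornerMX hornerC -xE mulVf // subrr.
Qed.

End PolynomialRing.

Section PolynomialRingField.
Variables (F : fieldType) (K : set F) (x : F).
Hypothesis hK : is_subfield K.
Local Notation Kx := (generated_subring (K `|` [set x])).
Let hR := subfield_subring hK.

(** The generator is the nonzero value in [I] of a polynomial of least degree;
    this covers an algebraic [x] as well. *)
Lemma polynomial_ring_pid : is_pid Kx.
Proof.
have hKx := generated_subringP K x.
split=> // I [IK I0 Iadd Imul].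
have [h|/existsNP [y /not_implyP [Iy /eqP y0]]] := pselect (forall x, I x -> x = 0).
  by exists 0 => // z /h ->; exists 0; [exact: subring0|rewrite mul0r].
pose P n := `[< exists p : {poly F}, [/\ forall i, K p`_i, size p = n, I p.[x] & p.[x] != 0] >].
have exP : exists n, P n.
  have /(generated_subring_poly x hR) [p pK yE] := IK _ Iy.
  by exists (size p); apply/asboolP; exists p; rewrite -yE.
have [n /asboolP [p [pK pn Ip px0]] pmin] := find_ex_minn exP.
have p0 : p != 0 by apply: contra_neq px0 => ->; rewrite horner0.
exists p.[x] => // z Iz; have /(generated_subring_poly x hR) [q qK zE] := IK _ Iz.
have [s [t [sK tK tp qE]]] := subring_modp hR p0 pK (subfield_inv hK (pK _)) qK.
have Ks : Kx s.[x] by apply/generated_subring_poly => //; exists s.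
exists s.[x] => //; rewrite zE qE hornerD hornerM.
suff -> : t.[x] = 0 by rewrite addr0.
apply: contrapT => /eqP tx0; have /pmin : P (size t).
  apply/asboolP; exists t; split=> //.
  have -> : t.[x] = z + (- s.[x]) * p.[x] by rewrite zE qE hornerD hornerM; ring.
  by apply: Iadd => //; apply: Imul => //; apply: (subringN hKx).
by rewrite leqNgt -pn tp.
Qed.

(** A residue class modulo [q.[x]] is coloured by the coefficients of a
    representative of degree less than that of [q]. *)
Lemma polynomial_ring_finite_residues : finite_coloring K -> finite_residues Kx.
Proof.
move=> [T [c cP]] _ /(generated_subring_poly x hR) [q qK ->] q0.
have {}q0 : q != 0 by apply: contra_neq q0 => ->; rewrite horner0.
have /choice [r rP] y : exists r : {poly F}, Kx y ->
    [/\ forall i, K r`_i, (size r < size q)%N & exists2 z, Kx z & y = z * q.[x] + r.[x]].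
  have [/(generated_subring_poly x hR) [p pK yE]|yK] := pselect (Kx y); last by exists 0.
  have [s [t [sK tK tq pE]]] := subring_modp hR q0 qK (subfield_inv hK (qK _)) pK.
  exists t => _; split=> //; exists s.[x]; last by rewrite yE pE hornerD hornerM.
  by apply/generated_subring_poly => //; exists s.
exists {ffun 'I_(size q) -> T}, (fun y => [ffun i : 'I_(size q) => c (r y)`_i]).
move=> a b /rP [raK ra [za Kza aE]] /rP [rbK rb [zb Kzb bE]] /ffunP rE.
have rab : r a = r b.
  apply/polyP => i; have [iq|qi] := ltnP i (size q).
    by apply: cP => //; have := rE (Ordinal iq); rewrite !ffunE.
  by rewrite !nth_default // (leq_trans _ qi) // ltnW.
exists (za - zb); first by apply: (subringB (generated_subringP K x)).
by rewrite aE bE rab; ring.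
Qed.

End PolynomialRingField.

(** * Algebraic elements and transcendence degree one *)

Lemma algebraic_over_sub (F : fieldType) (K L : set F) x :
  is_subring K -> is_subring L -> K `<=` L -> algebraic_over K x -> algebraic_over L x.
Proof.
move=> hK hL KL /(algebraic_over_coef hK) [p [p0 pK px]].
by apply/(algebraic_over_coef hL); exists p; split=> // i; apply: KL.
Qed.

Lemma generated_subfieldP (F : fieldType) (A : set F) : is_subfield (generated_subfield A).
Proof.
split=> [|y z|y z].
- by apply: mem_set => L [hL _]; apply: set_mem; case: hL.
- move=> /set_mem Ay /set_mem Az; apply: mem_set => L [hL sL].
  by apply: (subringB (subfield_subring hL)); [apply: Ay|apply: Az].
- move=> /set_mem Ay /set_mem Az; apply: mem_set => L [hL sL].
  apply: (subringM (subfield_subring hL)); first exact: Ay.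
  by apply: (subfield_inv hL); apply: Az.
Qed.

Lemma integral_algebraic_over (F : fieldType) (K : set F) x :
  is_subring K -> integral_over K x -> algebraic_over K x.
Proof.
move=> hK /(integral_over_coef hK) [p [pm pK px]].
by apply/(algebraic_over_coef hK); exists p; split=> //; apply: monic_neq0.
Qed.

Lemma algebraic_elements_subfield (F : fieldType) (K R : set F) :
  is_subfield K -> is_subring R -> K `<=` R -> (forall x, R x -> algebraic_over K x) ->
  is_subfield R.
Proof.
move=> hK hR KR Ralg; apply: subring_subfield => // x Rx x0.
by apply: (algebraic_inv_mem hK) => //; apply: Ralg.
Qed.

(** A relation of [x] over [K[b]] is a polynomial relation between [x] and [b]
    over [K]; read as a relation of [b], its coefficients are polynomials in
    [x], not all zero because [x] is transcendental. *)
Lemma algebraic_exchange (F : fieldType) (K : set F) (x b : F) :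
  is_subring K -> ~ algebraic_over K x ->
  algebraic_over (generated_subring (K `|` [set b])) x ->
  algebraic_over (generated_subring (K `|` [set x])) b.
Proof.
move=> hK xK /(algebraic_over_coef (generated_subringP K b)) [p [p0 pK px]].
have /choice [f fP] i : exists f : {poly F}, (forall j, K f`_j) /\ p`_i = f.[b].
  by have /(generated_subring_poly b hK) [f fK fE] := pK i; exists f.
apply/(algebraic_over_coef (generated_subringP K x)).
have coefE j : (\sum_(i < size p) x ^+ i *: f i)`_j = (\poly_(i < size p) (f i)`_j).[x].
  by rewrite coef_sum horner_poly; apply: eq_bigr => i _; rewrite coefZ mulrC.
exists (\sum_(i < size p) x ^+ i *: f i); split.
- apply: contra_notN xK => /eqP Q0; apply/(algebraic_over_coef hK).
  have fl0 : f (size p).-1 != 0.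
    apply: contra_neq p0 => fl0; apply/eqP; rewrite -lead_coef_eq0 lead_coefE.
    by have [_ ->] := fP (size p).-1; rewrite fl0 horner0.
  exists (\poly_(i < size p) (f i)`_(size (f (size p).-1)).-1); split.
  + apply: contra_neq fl0 => /(congr1 (fun q : {poly F} => q`_(size p).-1)).
    rewrite coef_poly coef0 prednK ?size_poly_gt0 // leqnn => h.
    by apply/eqP; rewrite -lead_coef_eq0 lead_coefE h.
  + move=> i; rewrite coef_poly; case: ifP => _; last exact: subring0.
    by have [] := fP i.
  + by rewrite -coefE Q0 coef0.
- move=> j; rewrite coefE; apply/(generated_subring_poly x hK).
  exists (\poly_(i < size p) (f i)`_j) => // i; rewrite coef_poly.
  by case: ifP => _; [have [] := fP i|exact: subring0].
- rewrite horner_sum -[RHS]px horner_coef; apply: eq_bigr => i _.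
  by rewrite hornerZ mulrC; have [_ ->] := fP i.
Qed.

Lemma card_le1_sub_set1 (T : Type) (B : set T) (b0 : T) :
  (B #<= `I_1)%card -> exists b, B `<=` [set b].
Proof.
move=> /pcard_leP [f]; have f0 x : B x -> f x = 0%N.
  by move=> Bx; have /= := 'funS_f Bx; rewrite ltnS leqn0 => /eqP.
have [[b Bb]|B0] := pselect (exists b, B b); last by exists b0 => b Bb; case: B0; exists b.
exists b => x Bx; apply: 'inj_f; [exact: mem_set|exact: mem_set|].
exact: etrans (f0 x Bx) (esym (f0 b Bb)).
Qed.

(** The algebraic elements over [K(x)] form a subfield, which contains the
    transcendence basis by the exchange property. *)
Lemma trdeg_le1_algebraic (F : fieldType) (K : set F) (x : F) :
  is_subfield K -> trdeg_le K 1 -> ~ algebraic_over K x ->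
  forall y, algebraic_over (generated_subring (K `|` [set x])) y.
Proof.
move=> hK [B [_ algB] /(card_le1_sub_set1 0) [b Bb]] xK y.
have hR := subfield_subring hK.
have hKx := generated_subringP K x; have hKb := generated_subringP K b.
pose Qx := fraction_field (generated_subring (K `|` [set x])).
pose Qb := fraction_field (generated_subring (K `|` [set b])).
have hQx : is_subfield Qx := fraction_field_subfield hKx.
have hQb : is_subfield Qb := fraction_field_subfield hKb.
have xb : algebraic_over (generated_subring (K `|` [set b])) x.
  apply: algebraic_over_fraction_field => //; first exact: subfield_subring.
  apply: algebraic_over_sub (algB x); try exact/subfield_subring/generated_subfieldP.
    exact: subfield_subring.
  apply: smallest_sub => // z [Kz|/Bb ->]; apply: sub_fraction_field => //.
    exact: sub_generated_subring.
  exact: mem_generated_subring.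
pose L := integral_closure Qx [set: F].
have hL : is_subfield L := integral_closure_subfield hQx.
have QL : Qx `<=` L := sub_integral_closure (subfield_subring hQx).
have Lb : L b.
  split=> //; apply: algebraic_integral_over => //.
  apply: algebraic_over_sub (algebraic_exchange hR xK xb) => //; first exact: subfield_subring.
  exact: sub_fraction_field.
have yL : algebraic_over L y.
  apply: algebraic_over_sub (algB y); try exact/subfield_subring/generated_subfieldP.
    exact: subfield_subring.
  apply: smallest_sub => // z [Kz|/Bb -> //]; apply: QL; apply: sub_fraction_field => //.
  exact: sub_generated_subring.
have /(integral_over_coef (subfield_subring hL)) [p [pm pL py]] := algebraic_integral_over hL yL.
have [_ yQ] := integral_closure_root (subfield_subring hQx) pm pL py.
apply: algebraic_over_fraction_field => //; first exact: subfield_subring.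
exact: integral_algebraic_over (subfield_subring hQx) yQ.
Qed.

Lemma transcendental_independent (F : fieldType) (K : set F) (x : F) :
  is_subring K -> ~ algebraic_over K x -> algebraically_independent K [set x].
Proof.
move=> hK xK [|[|n]] t tU tx q qK qt.
- by move: qt; rewrite [q]nvar0_mpolyC mevalC => ->; rewrite mpolyC0.
- have t0 i : tnth t i = x by apply: tx; rewrite /= mem_tnth.
  have qmK m : m \in msupp q -> K q@_m.
    by move=> mq; apply: set_mem; apply: (allP qK); apply: map_f.
  (* A monomial in one variable is determined by its total degree. *)
  pose P := \sum_(m <- msupp q) q@_m *: 'X^(mdeg m).
  have Px : P.[x] = 0.
    rewrite horner_sum -[RHS]qt mevalE; apply: eq_bigr => m _.
    by rewrite hornerZ hornerXn mdegE !big_ord1 t0.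
  have PE m : m \in msupp q -> P`_(mdeg m) = q@_m.
    move=> mq; rewrite coef_sum (bigD1_seq m) //= coefZ coefXn eqxx mulr1 big1 ?addr0 //.
    move=> m' m'm; rewrite coefZ coefXn; case: eqP => [|_]; last by rewrite mulr0.
    rewrite !mdegE !big_ord1 => mm; case/eqP: m'm; apply/mnmP => i.
    by rewrite ord1.
  have P0 : P = 0.
    apply: contra_notP xK => /eqP P0; apply/(algebraic_over_coef hK); exists P; split=> // i.
    rewrite coef_sum big_seq; apply: (subring_sum hK) => m mq.
    by rewrite coefZ coefXn; apply: (subringM hK); [exact: qmK|exact: (subring_nat hK)].
  apply/mpolyP => m; rewrite mcoeff0; have [mq|/memN_msupp_eq0 //] := boolP (m \in msupp q).
  by rewrite -PE // P0 coef0.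
- have t0 i : tnth t i = x by apply: tx; rewrite /= mem_tnth.
  by have /tuple_uniqP /(_ ord0 ord_max) := tU; rewrite !t0 => /(_ erefl).
Qed.

Lemma trdeg_le1_of_transcendental (F : fieldType) (K : set F) (x : F) :
  is_subring K -> ~ algebraic_over K x ->
  (forall y, algebraic_over (generated_subring (K `|` [set x])) y) -> trdeg_le K 1.
Proof.
move=> hK xK algx; exists [set x]; last first.
  by have /card_eqPle [] := @card_set1 _ x.
split=> [|y]; first exact: transcendental_independent.
have hG := generated_subfieldP (K `|` [set x]).
apply: algebraic_over_sub (algx y); [exact: generated_subringP|exact: subfield_subring|].
by apply: smallest_sub; [exact: subfield_subring|exact: sub_gen_smallest].
Qed.

Lemma trdeg_le_of_algebraic (F : fieldType) (K : set F) n :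
  is_subring K -> (forall y, algebraic_over K y) -> trdeg_le K n.
Proof.
move=> hK alg; exists set0; last exact: card_ge0.
split=> [|y].
  move=> [|k] t _ t0 q _ qt; last by case: (t0 (tnth t ord0)); rewrite /= mem_tnth.
  by move: qt; rewrite [q]nvar0_mpolyC mevalC => ->; rewrite mpolyC0.
apply: algebraic_over_sub (alg y) => //; first exact/subfield_subring/generated_subfieldP.
by move=> z Kz; apply: sub_gen_smallest; left.
Qed.

(** * Hereditarily atomic fields *)

Lemma subfield_dedekind (F : fieldType) (L : set F) : is_subfield L -> dedekind L.
Proof.
move=> hL; have hR := subfield_subring hL.
have full I y : is_ideal L I -> I y -> y != 0 -> I = L.
  move=> [IL _ _ Imul] Iy y0; apply/seteqP; split=> // z Lz.
  rewrite -[z](divfK y0); apply: Imul => //; apply: (subringM hR) => //.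
  by apply: (subfield_inv hL); apply: IL.
have zero_or_full I : is_ideal L I -> I = [set 0] \/ I = L.
  move=> idI; have [[y Iy y0]|h] := pselect (exists2 y, I y & y != 0).
    by right; apply: full Iy y0.
  left; apply/seteqP; split=> y; last by move=> ->; case: idI.
  by move=> Iy; apply: contrapT => /eqP y0; apply: h; exists y.
split=> //.
- move=> I idI; exists (if `[< I = L >] then [:: 1] else [::]).
    by case: asboolP => [->|_] // z /=; rewrite inE => /eqP ->; exact: subring1.
  apply/seteqP; split; last first.
    apply: smallest_sub => //; case: asboolP => [->|_] // z /=.
    by rewrite inE => /eqP ->; exact: subring1.
  move=> z Iz J [idJ sJ]; case: asboolP sJ => [IL sJ|nIL _].
    have J1 : J 1 by apply: sJ; rewrite /= mem_head.
    by rewrite (full J 1 idJ J1 (oner_neq0 F)) -IL.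
  case: (zero_or_full I idI) => [I0|//]; case: idJ => _ J0 _ _.
  by move: Iz; rewrite I0 => ->.
- apply/seteqP; split=> x.
    move=> [[a [b [La Lb _ ->]]] _]; apply: (subringM hR) => //; exact: (subfield_inv hL).
  move=> Lx; split; first exact: sub_fraction_field.
  by have [] := sub_integral_closure hR Lx.
- by move=> P [idP PL _] P0; case: (zero_or_full P idP).
Qed.

Lemma subfield_atomic (F : fieldType) (L : set F) : is_subfield L -> atomic L.
Proof.
move=> hL x Lx /eqP x0 []; split=> //; exists x^-1; first exact: subfield_inv.
exact: mulfV.
Qed.

Lemma closure_pid_dedekind (F : fieldType) (A : set F) :
  is_pid A -> finite_residues A -> (forall x, algebraic_over A x) ->
  hereditarily_atomic [set: F] -> dedekind (integral_closure A [set: F]).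
Proof.
move=> pidA finA algA atF; have [hA _] := pidA; have hO := integral_closure_subring hA.
have idO := closure_pid_idempotent_powers pidA finA.
split=> //.
- exact: atomic_prufer_noetherian (closure_pid_prufer pidA algA) atF.
- exact: integral_closure_closed.
- exact: idempotent_powers_prime_maximal.
Qed.

Lemma overring_closure_pid_atomic (F : fieldType) (A S : set F) :
  is_pid A -> (forall x, algebraic_over A x) ->
  dedekind (integral_closure A [set: F]) -> is_subring S -> A `<=` S -> atomic S.
Proof.
move=> pidA algA [hO noethO _ _] hS AS; have [hA _] := pidA.
apply: (noetherian_prufer_atomic hO noethO (closure_pid_prufer pidA algA) hS) => x [_].
exact: integral_over_sub.
Qed.

Lemma char0_intr_eq0 (F : fieldType) (n : int) :
  [pchar F] =i pred0 -> (n%:~R == 0 :> F) = (n == 0).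
Proof.
move=> /pcharf0P F0; case: n => n; first exact: F0.
by rewrite NegzE rmorphN !oppr_eq0; apply: (F0 n.+1).
Qed.

Lemma algebraicOver_ratr (F : fieldType) (x : F) : [pchar F] =i pred0 ->
  algebraicOver (ratr : rat -> F) x <-> algebraic_over (prime_subring F) x.
Proof.
move=> F0; have hZ := prime_subringP F.
have ratr0 : ratr 0 = 0 :> F := ratr_int F 0.
split=> [[p p0 px]|].
  apply: algebraic_over_fraction_field => //; first exact/subfield_subring/fraction_field_subfield.
  apply/algebraic_over_coef; first exact/subfield_subring/fraction_field_subfield.
  exists (map_poly (ratr : rat -> F) p); split; last exact/rootP.
    apply: contra_neq p0 => /(congr1 (fun q : {poly F} => q`_(size p).-1)).
    rewrite coef_map_id0 // coef0 /ratr => /eqP; rewrite mulf_eq0 invr_eq0 !char0_intr_eq0 //.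
    by rewrite (negPf (denq_neq0 _)) orbF numq_eq0 -lead_coefE lead_coef_eq0 => /eqP.
  move=> i; rewrite coef_map_id0 //; exists (numq p`_i)%:~R, (denq p`_i)%:~R.
  split=> //; [by exists (numq p`_i)|by exists (denq p`_i)|].
  by apply/eqP; rewrite char0_intr_eq0 // denq_neq0.
move=> /(algebraic_over_coef hZ) [p [p0 pZ px]].
have /choice [c cP] i : exists n : int, p`_i = n%:~R by have [n _ <-] := pZ i; exists n.
have pE : map_poly (ratr : rat -> F) (\poly_(i < size p) (c i)%:~R) = p.
  apply/polyP => i; rewrite coef_map_id0 // coef_poly.
  case: ltnP => ip; first by rewrite ratr_int -cP.
  by rewrite nth_default // ratr0.
exists (\poly_(i < size p) (c i)%:~R); last by rewrite pE; apply/rootP.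
apply: contra_neq p0 => q0; rewrite -pE q0; apply/polyP => i.
by rewrite coef_map_id0 // !coef0 ratr0.
Qed.

Theorem theorem4p4 (F : fieldType) :
  ([pchar F] =i pred0 ->
     (hereditarily_atomic [set: F] <->
      (forall x : F, algebraicOver (ratr : rat -> F) x) /\
      dedekind (integral_closure (prime_subring F) [set: F]))) /\
  (forall p : nat, p \in [pchar F] ->
     (hereditarily_atomic [set: F] <->
      trdeg_le (prime_subring F) 1 /\
      forall x : F,
        dedekind (integral_closure
          (generated_subring (prime_subring F `|` [set x])) [set: F]))).
Proof.
have hZ := prime_subringP F; split=> [F0|p pF].
  have pidZ := prime_subring_pid F; split=> [atF|[algQ dedO]]; last first.
    move=> S hS _; apply: (overring_closure_pid_atomic pidZ) => //.
      by move=> x; apply/algebraicOver_ratr.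
    exact: prime_subring_sub.
  have algZ x : algebraic_over (prime_subring F) x.
    (* For transcendental [x], the ring Z + x Z[1/2][x] is not atomic. *)
    have F2 : 2%:R != 0 :> F by have /pcharf0P -> := F0.
    apply: contrapT => xZ.
    apply: (transcendental_not_hereditarily_atomic hZ (subring_nat hZ 2) F2 _ xZ atF).
    move=> [n _ n2]; have : (n * 2 - 1)%:~R == 0 :> F.
      by rewrite rmorphB rmorphM /= n2 mulVf // subrr.
    rewrite char0_intr_eq0 // subr_eq0 => /eqP /(congr1 (fun k => `|k|%N)).
    by rewrite abszM /= => /(congr1 odd); rewrite oddM andbF.
  split; first by move=> x; apply/algebraicOver_ratr.
  exact: (closure_pid_dedekind pidZ (@prime_subring_finite_residues F)).
have finK := prime_subring_finite pF; have hK := finite_subring_subfield hZ finK.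
set K := prime_subring F in hZ finK hK *.
split=> [atF|[trF dedF] S hS _]; last first.
  have KS : K `<=` S := prime_subring_sub hS.
  have [Salg|] := pselect (forall x, S x -> algebraic_over K x).
    exact/subfield_atomic/(algebraic_elements_subfield hK).
  move=> /existsNP [x /not_implyP [Sx xK]].
  apply: (overring_closure_pid_atomic (polynomial_ring_pid x hK)) => //.
    exact: trdeg_le1_algebraic.
  by apply: smallest_sub => // y [/KS|/= ->].
have transc x : ~ algebraic_over K x ->
    forall y, algebraic_over (generated_subring (K `|` [set x])) y.
  move=> xK y; apply: contrapT => yK; have [x0 xV] := transcendental_inv_notin hZ xK.
  exact: (transcendental_not_hereditarily_atomic (generated_subringP K x)
    (@mem_generated_subring _ K x) x0 xV yK atF).
split=> [|x].
  have [algK|] := pselect (forall y, algebraic_over K y).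
    exact: trdeg_le_of_algebraic.
  by move=> /existsNP [x xK]; apply: (trdeg_le1_of_transcendental hZ xK); apply: transc.
have [xK|xK] := pselect (algebraic_over K x); last first.
  apply: (closure_pid_dedekind (polynomial_ring_pid x hK)) => //; last exact: transc.
  exact: polynomial_ring_finite_residues.
apply/subfield_dedekind/integral_closure_subfield.
apply: (algebraic_elements_subfield hK (generated_subringP K x)).
  exact: sub_generated_subring.
move=> y Ky; apply: (integral_algebraic_over hZ).
suff [_ //] : integral_closure K [set: F] y.
apply: (smallest_sub _ _ Ky); first exact: integral_closure_subring.
move=> z [Kz|/= ->]; first exact: sub_integral_closure.
by split=> //; apply: algebraic_integral_over.
Qed.
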